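(* Let $S$ be a $\mathcal U_n$-invariant and accessible subspace of $C(\mathcal U_n)$ which is closed in $L_2(\mathcal U_n)$. Then $$\boldsymbol{\lambda}(S)=\big\|\pi_S\colon C(\mathcal U_n)\to S\big\|=\int_{\mathcal U_n}|\mathrm t_S(V)|\,dV .$$
   Context: All Banach spaces are complex. $\mathcal U_n$ is the compact group of unitary $n\times n$ matrices, $dV$ its Haar probability measure, $L_2(\mathcal U_n)$ the corresponding Hilbert space, and $C(\mathcal U_n)$ carries the supremum norm; subspaces $S$ of $C(\mathcal U_n)$ are viewed as Banach spaces with the supremum norm. For $V\in\mathcal U_n$ let $L_V(U)=VU$, $R_V(U)=UV$, and $C_{L_V}f=f\circ L_V$, $C_{R_V}f=f\circ R_V$. A subspace of $L_2(\mathcal U_n)$ is $\mathcal U_n$-invariant if it is invariant under all $C_{L_V}$ and $C_{R_V}$, $V\in\mathcal U_n$. A linear map $T$ between $\mathcal U_n$-invariant subspaces (or on $C(\mathcal U_n)$) commutes with the action of $\mathcal U_n\times\mathcal U_n$ on $C(\mathcal U_n)$ if $C_{L_U}C_{R_V}(Tf)=T(C_{L_U}C_{R_V}f)$ for all $U,V\in\mathcal U_n$ and all $f$ in the domain of $T$. For a closed subspace $S$ of $L_2(\mathcal U_n)$, $\pi_S$ is the orthogonal projection of $L_2(\mathcal U_n)$ onto $S$. If $S$ is a $\mathcal U_n$-invariant subspace of $C(\mathcal U_n)$ closed in $L_2(\mathcal U_n)$, then $\mathrm t_S$ denotes the unique function in $S$ with $(\pi_Sf)(\mathrm{Id})=\langle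 f,\mathrm t_S\rangle_{L_2}$ for all $f\in L_2(\mathcal U_n)$; equivalently, the unique function in $S$ with $\pi_Sf=f*\mathrm t_S$ for all $f\in L_2(\mathcal U_n)$, where $(f*g)(U)=\int_{\mathcal U_n}f(V)g(UV^* )\,dV$. Such an $S$ is accessible if every bounded linear projection $Q$ of $C(\mathcal U_n)$ onto $S$ which commutes with the action of $\mathcal U_n\times\mathcal U_n$ on $C(\mathcal U_n)$ equals $\pi_S|_{C(\mathcal U_n)}$. For a subspace $X$ of a Banach space $Y$, $\boldsymbol{\lambda}(X,Y)=\inf\{\|P\| : P\in\mathcal L(Y,X),\ P|_X=\mathrm{Id}_X\}$ (with $\inf\varnothing=\infty$), and $\boldsymbol{\lambda}(X)=\sup\boldsymbol{\lambda}(I(X),Y)$ over all Banach spaces $Y$ and isometric linear embeddings $I\colon X\to Y$. *)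

(* Defs.v *)
From HB Require Import structures.
From mathcomp Require Import all_boot all_order all_algebra spectral.
From mathcomp Require Import complex.
From mathcomp Require Import all_classical all_reals all_analysis.
Set Implicit Arguments.
Unset Strict Implicit.
Unset Printing Implicit Defensive.
Import Order.TTheory GRing.Theory Num.Theory.
Import numFieldNormedType.Exports.
Local Open Scope classical_set_scope.
Local Open Scope ring_scope.

(* R[i] as a structured type, so that R[i] gets its norm topology. *)
Definition Cx (R : realType) : numClosedFieldType := R[i].

(** ** Operator norms and projection constants *)

(* In the library the norm of a normed space over R[i] takes its values in R[i];
   it is a nonnegative real number, of which we take the real part. *)
Definition rnorm (R : realType) (V : normedZmodType (Cx R)) (v : V) : R :=
  complex.Re (`|v| : R[i]).

Definition enorm (R : realType) (V : normedZmodType (Cx R)) (v : V) : \bar R :=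
  (rnorm v)%:E.

(* Norm of T as an operator from the subspace D of V, normed by N, to W,
   normed by M. *)
Definition opnorm (R : realType) (V W : Type) (N : V -> \bar R) (D : set V)
    (M : W -> \bar R) (T : V -> W) : \bar R :=
  ereal_sup [set M (T v) | v in [set v | D v /\ (N v <= 1)%E]].

Definition linear_on (K : nzRingType) (V W : lmodType K) (D : set V)
    (T : V -> W) : Prop :=
  forall (a : K) (u v : V), D u -> D v -> T (a *: u + v) = a *: T u + T v.

(* T restricted to D is a bounded linear projection of the subspace D of V,
   normed by N, onto the subspace X of D. *)
Definition bounded_projection (R : realType) (V : lmodType (Cx R))
    (N : V -> \bar R) (D X : set V) (T : V -> V) : Prop :=
  [/\ linear_on D T,
      (opnorm N D N T < +oo)%E,
      (forall v, D v -> X (T v)) &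
      (forall x, X x -> T x = x)].

Definition relative_projection_constant (R : realType)
    (Y : normedModType (Cx R)) (X : set Y) : \bar R :=
  ereal_inf [set opnorm (@enorm R Y) setT (@enorm R Y) P |
             P in bounded_projection (@enorm R Y) setT X].

Definition isometric_embedding (R : realType) (V : lmodType (Cx R))
    (N : V -> \bar R) (X : set V) (Y : normedModType (Cx R)) (I : V -> Y) :
    Prop :=
  linear_on X I /\ forall x, X x -> enorm (I x) = N x.

(* X is a subspace of V, normed by N; only the values of I on X matter. *)
Definition projection_constant (R : realType) (V : lmodType (Cx R))
    (N : V -> \bar R) (X : set V) : \bar R :=
  ereal_sup [set r | exists (Y : completeNormedModType (Cx R)) (I : V -> Y),
    isometric_embedding N X I /\ r = relative_projection_constant (I @` X)].

(** ** The unitary group *)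

Definition unitary_group (R : realType) (n : nat) : Type :=
  set_type [set V : 'M[Cx R]_n | V \is unitarymx].

HB.instance Definition _ (R : realType) (n : nat) :=
  Topological.copy (unitary_group R n)
    (set_type [set V : 'M[Cx R]_n | V \is unitarymx]).

Lemma unitarymx1 (R : realType) (n : nat) :
  (1%:M : 'M[Cx R]_n) \in [set V : 'M[Cx R]_n | V \is unitarymx].
Proof. by apply/mem_set/unitarymxP; rewrite trmx1 map_mx1 mulmx1. Qed.

Definition unitary1 (R : realType) (n : nat) : unitary_group R n :=
  exist _ 1%:M (unitarymx1 R n).

Lemma unitarymxM (R : realType) (n : nat) (U V : unitary_group R n) :
  \val U *m \val V \in [set V : 'M[Cx R]_n | V \is unitarymx].
Proof.
apply/mem_set/mul_unitarymx.
  exact: (set_mem (valP U)).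
exact: (set_mem (valP V)).
Qed.

Definition unitaryM (R : realType) (n : nat) (U V : unitary_group R n) :
  unitary_group R n := exist _ (\val U *m \val V) (unitarymxM U V).

HB.instance Definition _ (R : realType) (n : nat) :=
  isPointed.Build (unitary_group R n) (unitary1 R n).

(* Borel sigma-algebra *)
Definition unitary_display : measure_display. Proof. exact: default_measure_display. Qed.

HB.instance Definition _ (R : realType) (n : nat) :=
  @isMeasurable.Build unitary_display (unitary_group R n)
    <<s (@open (unitary_group R n)) >> (@sigma_algebra0 _ setT _)
    (@sigma_algebraC _ _) (@sigma_algebra_bigcup _ setT _).

Definition translL (R : realType) (n : nat) (V U : unitary_group R n) :=
  unitaryM V U.
Definition translR (R : realType) (n : nat) (V U : unitary_group R n) :=
  unitaryM U V.

(* U_n is compact and metrizable, so that every Borel probability measure on it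
   is regular. *)
Definition is_haar (R : realType) (n : nat)
    (mu : probability (unitary_group R n) R) : Prop :=
  forall (V : unitary_group R n) (A : set (unitary_group R n)), measurable A ->
    mu (translL V @^-1` A) = mu A /\ mu (translR V @^-1` A) = mu A.

(** ** Function spaces on the unitary group *)

Section FunctionSpaces.
Variables (R : realType) (n : nat) (mu : probability (unitary_group R n) R).
Local Notation U := (unitary_group R n).
Implicit Types (f g : U -> Cx R) (S : set (U -> Cx R)).

Definition Cspace : set (U -> Cx R) := [set f | continuous f].

Definition supnorm f : \bar R := ereal_sup [set enorm (f V) | V in setT].

(* Elements of L_2 are represented by square integrable functions. *)
Definition L2space : set (U -> Cx R) :=
  [set f | [/\ measurable_fun setT (fun V => complex.Re (f V)),
               measurable_fun setT (fun V => complex.Im (f V)) &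
               (\int[mu]_V (rnorm (f V) ^+ 2)%:E < +oo)%E]].

Definition cintegral f : Cx R :=
  Complex (\int[mu]_V complex.Re (f V)) (\int[mu]_V complex.Im (f V)).

Definition L2inner f g : Cx R := cintegral (fun V => f V * (g V)^*).

Definition is_subspace S : Prop :=
  S 0 /\ forall (a : Cx R) f g, S f -> S g -> S (a *: f + g).

Definition unitary_invariant S : Prop :=
  forall (V : U) f, S f -> S (f \o translL V) /\ S (f \o translR V).

(* S, or rather the set of classes of its elements, contains its closure. *)
Definition L2closed S : Prop :=
  forall f, L2space f ->
    (forall e : R, 0 < e ->
       exists g, S g /\ (\int[mu]_V (rnorm (f V - g V) ^+ 2)%:E < e%:E)%E) ->
  exists g, S g /\ {ae mu, forall V, f V = g V}.

(* The orthogonal projection onto S: pi_S f is the element g of S such that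
   f - g is orthogonal to S.  When S consists of continuous functions this
   determines the function g, not just its class. *)
Definition L2proj S f : U -> Cx R :=
  xget 0 [set g | S g /\ forall h, S h -> L2inner (f - g) h = 0].

Definition repr_kernel S : U -> Cx R :=
  xget 0 [set t | S t /\
    forall f, L2space f -> L2proj S f (unitary1 R n) = L2inner f t].

Definition commutes_with_action (T : (U -> Cx R) -> (U -> Cx R)) : Prop :=
  forall (V W : U) f, Cspace f ->
    (T f \o translR W) \o translL V = T ((f \o translR W) \o translL V).

Definition accessible S : Prop :=
  forall Q : (U -> Cx R) -> (U -> Cx R),
    bounded_projection supnorm Cspace S Q ->
    commutes_with_action Q ->
    forall f, Cspace f -> Q f = L2proj S f.

End FunctionSpaces.

(* Main.v *)
(** The evaluation at a point is bounded on S for the L_2 norm: otherwise one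
    builds by a gliding hump an L_2 Cauchy sequence in S whose limit agrees almost
    everywhere with no bounded function.  Hence the size of an orthonormal family
    in S is bounded, S is spanned by finitely many e_i, and pi_S is given by the
    kernel k(x, y) = sum_i conj (e_i x) * e_i y.  By invariance k(x, _) is a
    translate of t_S = k(Id, _), so that all these functions have the same L_1
    norm.  The theorem is the cycle of inequalities
    int |t_S| <= ||pi_S|| <= lambda(S) <= int |t_S|.

    - First inequality: apply pi_S to t_S / (|t_S| + d) and evaluate at Id.
    - Second one: embed S in the Banach space of all bounded functions, restrict a
      projection onto S to the continuous functions, and average it over left and
      then over right translations; accessibility says that the result is pi_S.
    - Third one: given an isometry I of S into Y, extend each evaluation
      functional to h_x on Y with norm at most 1, extend the integral to a positive
      functional L on all bounded functions (x |-> h_x y need not be measurable),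
      and project y onto I (sum_i L(x |-> h_x y * conj (e_i x)) e_i). *)

(* The obstacle throughout is vector-valued integration. Once S has a finite orthonormal basis,
   membership in S of an average, or of a value of the constructed projection, is read off from
   finitely many scalar coefficients, so only scalar integrals over the group occur. Averaging over
   one side at a time avoids a product measure, and the second average keeps the symmetry gained by
   the first because left and right translations commute. The Hahn-Banach theorem is used in the
   form that every sublinear functional dominates a linear one; the values prescribed on a subspace
   are built into the sublinear functional as an infimum. The extensions of the evaluations and of
   the integral are two instances. The bound by int |t_S| needs one estimate for the whole sum over
   i: termwise bounds would lose the cancellation inside the kernel. The term d regularizes t_S /
   |t_S|, which need not be continuous where t_S vanishes. *)
Require Import Defs.
From HB Require Import structures.
From mathcomp Require Import all_boot all_order all_algebra spectral finmap.
From mathcomp Require Import complex.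
From mathcomp Require Import all_classical all_reals all_analysis measurable_realfun.
From mathcomp Require Import ring lra.
Set Implicit Arguments.
Unset Strict Implicit.
Unset Printing Implicit Defensive.
Import Order.TTheory GRing.Theory Num.Theory.
Import numFieldNormedType.Exports.
Local Open Scope classical_set_scope.
Local Open Scope ring_scope.
Local Notation Re := (@complex.Re _).
Local Notation Im := (@complex.Im _).

(** * Complex scalars *)

Section Scalars.
Variable R : realType.
Implicit Types (z w : Cx R).

Lemma normE (V : normedZmodType (Cx R)) (v : V) : `|v| = ((rnorm v)%:C)%C :> Cx R.
Proof. by rewrite /rnorm; have := normr_ge0 v; rewrite lecE => /andP[/eqP h _]; case: (`|v|) h => a b /= ->. Qed.

Lemma rnorm_ge0 (V : normedZmodType (Cx R)) (v : V) : 0 <= rnorm v.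
Proof. by have := normr_ge0 v; rewrite normE ler0c. Qed.

Lemma rnormD (V : normedZmodType (Cx R)) (u v : V) :
  rnorm (u + v) <= rnorm u + rnorm v.
Proof. by rewrite -lecR rmorphD /= -!normE ler_normD. Qed.

Lemma rnormN (V : normedZmodType (Cx R)) (v : V) : rnorm (- v) = rnorm v.
Proof. by rewrite /rnorm normrN. Qed.

Lemma rnorm0 (V : normedZmodType (Cx R)) : rnorm (0 : V) = 0.
Proof. by rewrite /rnorm normr0. Qed.

Lemma rnorm_eq0 (V : normedZmodType (Cx R)) (v : V) : rnorm v = 0 -> v = 0.
Proof. by move=> v0; apply/normr0_eq0; rewrite normE v0. Qed.

Lemma rnorm_dist (V : normedZmodType (Cx R)) (u v : V) :
  `|rnorm u - rnorm v| <= rnorm (u - v).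
Proof.
have h x y : rnorm x - rnorm y <= rnorm (x - y :> V) by rewrite lerBlDr -{1}(subrK y x) rnormD.
rewrite ler_norml h andbT lerNl.
by rewrite [leLHS]opprB -(rnormN (u - v)) [- (u - v)]opprB h.
Qed.

Lemma rnormZ (V : normedModType (Cx R)) a (v : V) :
  rnorm (a *: v) = rnorm a * rnorm v.
Proof. by apply: complexI; rewrite rmorphM /= -!normE normrZ. Qed.

Lemma rnormM z w : rnorm (z * w) = rnorm z * rnorm w.
Proof. by apply: complexI; rewrite rmorphM /= -!normE normrM. Qed.

Lemma rnormr (x : R) : rnorm (x%:C%C : Cx R) = `|x|.
Proof. by rewrite /rnorm normc_def /= expr0n /= addr0 sqrtr_sqr. Qed.

Lemma sqr_rnorm z : rnorm z ^+ 2 = Re z ^+ 2 + Im z ^+ 2.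
Proof. by rewrite /rnorm normc_def /= sqr_sqrtr // addr_ge0 // sqr_ge0. Qed.

Lemma conjE z : z^* = Complex (Re z) (- Im z).
Proof. by case: z. Qed.

Lemma rnormJ z : rnorm z^* = rnorm z.
Proof. by rewrite /rnorm norm_conjC. Qed.

Lemma norm_Re_le z : `|Re z| <= rnorm z.
Proof.
rewrite -(@ler_pXn2r _ 2) ?nnegrE ?rnorm_ge0 // sqr_rnorm -normrX ger0_norm ?sqr_ge0 //.
by rewrite lerDl sqr_ge0.
Qed.

Lemma norm_Im_le z : `|Im z| <= rnorm z.
Proof.
rewrite -(@ler_pXn2r _ 2) ?nnegrE ?rnorm_ge0 // sqr_rnorm -normrX ger0_norm ?sqr_ge0 //.
by rewrite lerDr sqr_ge0.
Qed.

Lemma Re_le z : Re z <= rnorm z.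
Proof. exact: le_trans (ler_norm _) (norm_Re_le z). Qed.

Lemma rnorm_le z : rnorm z <= `|Re z| + `|Im z|.
Proof.
rewrite -(@ler_pXn2r _ 2) ?nnegrE ?rnorm_ge0 ?addr_ge0 // sqr_rnorm sqrrD.
rewrite -!normrX !(ger0_norm (sqr_ge0 _)) lerD2r lerDl mulrn_wge0 //.
Qed.

(** For z != 0 take conj z / |z|. This turns bounds on real parts into bounds on moduli, both for
    complex integrals and for complexified functionals. *)
Lemma rotation z : exists2 c : Cx R, rnorm c = 1 & c * z = ((rnorm z)%:C)%C.
Proof.
have [->|z0] := eqVneq z 0.
  by exists 1; rewrite ?mulr0 ?rnorm0 // /rnorm normr1.
have nz0 : rnorm z != 0 by apply: contra_neq z0 => /rnorm_eq0.
exists (z^* * ((rnorm z)^-1%:C)%C).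
  by rewrite rnormM rnormJ rnormr ger0_norm ?invr_ge0 ?rnorm_ge0 // divff.
rewrite mulrAC [z^* * z]mulrC -normCK normE -rmorphXn -rmorphM /=.
by rewrite expr2 mulfK.
Qed.

Lemma cReD z w : Re (z + w) = Re z + Re w. Proof. by case: z w => [? ?] []. Qed.
Lemma cImD z w : Im (z + w) = Im z + Im w. Proof. by case: z w => [? ?] []. Qed.
Lemma cReN z : Re (- z) = - Re z. Proof. by case: z. Qed.
Lemma cImN z : Im (- z) = - Im z. Proof. by case: z. Qed.
Lemma cReM z w : Re (z * w) = Re z * Re w - Im z * Im w.
Proof. by case: z w => [? ?] []. Qed.
Lemma cImM z w : Im (z * w) = Re z * Im w + Im z * Re w.
Proof. by case: z w => [? ?] []. Qed.
Lemma complex_ext z w : Re z = Re w -> Im z = Im w -> z = w.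
Proof. by case: z w => [a b] [c d] /= -> ->. Qed.

End Scalars.

(** * Topology of the unitary group *)

Section ComplexTopology.
Variable R : realType.

Lemma cvgCP (T : Type) (F : set_system T) (FF : Filter F) (f : T -> Cx R) (z : Cx R) :
  f @ F --> z <-> forall e : R, 0 < e -> \forall x \near F, rnorm (f x - z) < e.
Proof.
split=> [/cvgrPdist_lt h e e0|h].
  have : 0 < ((e%:C)%C : Cx R) by rewrite ltcR.
  by move=> /h; apply: filterS => x; rewrite -normrN opprB normE ltcR.
(* A positive element of [Cx R] has zero imaginary part, so a complex tolerance is a real one. *)
apply/cvgrPdist_lt => -[e e'] /=; rewrite ltcE /= => /andP[/eqP -> e0].
apply: filterS (h e e0) => x; rewrite -normrN opprB normE.
by rewrite -[Complex e 0]/((e%:C)%C) ltcR.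
Qed.

Lemma cvg_complex (T : Type) (F : set_system T) (FF : Filter F) (f : T -> Cx R) (z : Cx R) :
  (Re \o f) @ F --> Re z -> (Im \o f) @ F --> Im z -> f @ F --> z.
Proof.
move=> /cvgrPdist_lt fr /cvgrPdist_lt fi; apply/cvgCP => e e0.
have e20 : 0 < e / 2 by rewrite divr_gt0.
near=> x; rewrite (le_lt_trans (rnorm_le _))// cReD cImD cReN cImN [ltRHS](splitr e).
rewrite ltrD// distrC.
  by near: x; exact: fr.
by near: x; exact: fi.
Unshelve. all: by end_near. Qed.

Lemma cvg_Re (T : Type) (F : set_system T) (FF : Filter F) (f : T -> Cx R) (z : Cx R) :
  f @ F --> z -> (Re \o f) @ F --> Re z.
Proof.
move=> /cvgCP h; apply/cvgrPdist_lt => e /h; apply: filterS => x.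
by apply: le_lt_trans; rewrite distrC -cReN -cReD norm_Re_le.
Qed.

Lemma cvg_Im (T : Type) (F : set_system T) (FF : Filter F) (f : T -> Cx R) (z : Cx R) :
  f @ F --> z -> (Im \o f) @ F --> Im z.
Proof.
move=> /cvgCP h; apply/cvgrPdist_lt => e /h; apply: filterS => x.
by apply: le_lt_trans; rewrite distrC -cImN -cImD norm_Im_le.
Qed.

Lemma cvg_conj (T : Type) (F : set_system T) (FF : Filter F) (f : T -> Cx R) (z : Cx R) :
  f @ F --> z -> (fun x => (f x)^*) @ F --> z^*.
Proof.
move=> /cvgCP h; apply/cvgCP => e /h; apply: filterS => x.
by rewrite -rmorphB rnormJ.
Qed.

Lemma cvg_rnorm (T : Type) (F : set_system T) (FF : Filter F) (f : T -> Cx R) (z : Cx R) :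
  f @ F --> z -> (fun x => rnorm (f x)) @ F --> rnorm z.
Proof.
move=> /cvgCP h; apply/cvgrPdist_lt => e /h; apply: filterS => x.
by apply: le_lt_trans; rewrite distrC rnorm_dist.
Qed.

Lemma cvg_csum (T I : Type) (r : seq I) (F : set_system T) (FF : Filter F)
    (f : I -> T -> Cx R) (z : I -> Cx R) :
  (forall i, f i @ F --> z i) ->
  (fun x => \sum_(i <- r) f i x) @ F --> \sum_(i <- r) z i.
Proof.
move=> fz; elim: r => [|i r IH].
  by under [X in X @ _ --> _]funext do rewrite big_nil; rewrite big_nil; exact: cvg_cst.
under [X in X @ _ --> _]funext do rewrite big_cons.
by rewrite big_cons; exact: cvgD (fz i) IH.
Qed.

Section Continuous.
Variable T : topologicalType.
Implicit Types f g : T -> Cx R.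

Lemma continuous_Re f : continuous f -> continuous (fun x => Re (f x)).
Proof. by move=> cf x; apply: cvg_Re; exact: cf. Qed.

Lemma continuous_Im f : continuous f -> continuous (fun x => Im (f x)).
Proof. by move=> cf x; apply: cvg_Im; exact: cf. Qed.

Lemma continuous_rnorm f : continuous f -> continuous (fun x => rnorm (f x)).
Proof. by move=> cf x; apply: cvg_rnorm; exact: cf. Qed.

Lemma continuous_sqr_rnorm f : continuous f -> continuous (fun x => rnorm (f x) ^+ 2).
Proof. by move=> /continuous_rnorm c x; exact: cvgM (c x) (c x). Qed.

Lemma continuous_conj f : continuous f -> continuous (fun x => (f x)^* ).
Proof. by move=> cf x; apply: cvg_conj; exact: cf. Qed.

Lemma continuous_mul f g : continuous f -> continuous g -> continuous (fun x => f x * g x).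
Proof. by move=> cf cg x; exact: cvgM (cf x) (cg x). Qed.

Lemma continuous_cst (a : Cx R) : continuous (fun _ : T => a).
Proof. by move=> x; exact: cvg_cst. Qed.

Lemma continuous_realC (f : T -> R) : continuous f -> continuous (fun x => ((f x)%:C)%C : Cx R).
Proof. by move=> cf x; apply: cvg_complex; [exact: cf|exact: cvg_cst]. Qed.

End Continuous.

End ComplexTopology.

(** * Coordinatewise convergence, group operations and compactness *)

Section UnitaryTopology.
Variables (R : realType) (n : nat).
Local Notation U := (unitary_group R n).

Lemma cvg_unitary (F : set_system U) (FF : Filter F) (x : U) :
  (forall i j, (fun u : U => (\val u) i j) @ F --> (\val x) i j) -> F --> x.
Proof.
move=> h A; rewrite nbhsE => -[B [[C oC <-] Cx] BA].
have [P Px PC] : nbhs (\val x) C by exact: open_nbhs_nbhs.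
have : F [set u : U | forall i j, P i j ((\val u) i j)].
  by apply: filter_forall => i; apply: filter_forall => j; apply: h; exact: Px.
by apply: filterS => u Pu; apply: BA; exact: PC.
Qed.

Lemma cvg_unitary_coord (T : Type) (F : set_system T) (FF : Filter F)
    (f : T -> U) (x : U) i j :
  f @ F --> x -> (fun t => (\val (f t)) i j) @ F --> (\val x) i j.
Proof.
move=> fx; apply: (@cvg_comp _ _ _ f (fun u : U => (\val u) i j) F (nbhs x)) => //.
apply: (@cvg_comp _ _ _ \val (fun M : 'M[Cx R]_n => M i j) _ (nbhs (\val x))).
  exact: (@initial_continuous U _ _ x).
exact: coord_continuous.
Qed.

Lemma cvg_unitaryM (T : Type) (F : set_system T) (FF : Filter F) (f g : T -> U) (x y : U) :
  f @ F --> x -> g @ F --> y -> (fun t => unitaryM (f t) (g t)) @ F --> unitaryM x y.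
Proof.
move=> fx gy; apply: cvg_unitary => i j.
rewrite -[_ @ _]/((fun t => \val (unitaryM (f t) (g t)) i j) @ F) /= mxE.
under [X in X @ _ --> _]funext do rewrite mxE.
apply: cvg_csum => k; apply: cvgM; exact: cvg_unitary_coord.
Qed.

Lemma unitaryV_subproof (V : U) :
  ((\val V)^t* )%sesqui \in [set V : 'M[Cx R]_n | V \is unitarymx].
Proof.
apply/mem_set; rewrite /= trmxC_unitary.
exact: (set_mem (valP V)).
Qed.

Definition unitaryV (V : U) : U :=
  exist _ ((\val V)^t* )%sesqui (unitaryV_subproof V).

Lemma unitary_inj (x y : U) : \val x = \val y -> x = y.
Proof. exact: val_inj. Qed.

Lemma unitaryMV (V : U) : unitaryM V (unitaryV V) = unitary1 R n.
Proof.
by apply: unitary_inj => /=; apply/unitarymxP; exact: (set_mem (valP V)).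
Qed.

Lemma unitaryVM (V : U) : unitaryM (unitaryV V) V = unitary1 R n.
Proof. by apply: unitary_inj => /=; apply: mulmx1C; have /(congr1 \val) := unitaryMV V. Qed.

Lemma unitaryA (x y z : U) : unitaryM x (unitaryM y z) = unitaryM (unitaryM x y) z.
Proof. by apply: unitary_inj; rewrite /= mulmxA. Qed.

Lemma unitary1M (x : U) : unitaryM (unitary1 R n) x = x.
Proof. by apply: unitary_inj; rewrite /= mul1mx. Qed.

Lemma unitaryM1 (x : U) : unitaryM x (unitary1 R n) = x.
Proof. by apply: unitary_inj; rewrite /= mulmx1. Qed.

Lemma cvg_unitaryV (T : Type) (F : set_system T) (FF : Filter F) (f : T -> U) (x : U) :
  f @ F --> x -> (fun t => unitaryV (f t)) @ F --> unitaryV x.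
Proof.
move=> fx; apply: cvg_unitary => i j.
rewrite -[_ @ _]/((fun t => \val (unitaryV (f t)) i j) @ F) /= !mxE.
under [X in X @ _ --> _]funext do rewrite !mxE.
by apply: cvg_conj; exact: cvg_unitary_coord.
Qed.

Lemma continuous_unitaryM (T : topologicalType) (f g : T -> U) :
  continuous f -> continuous g -> continuous (fun t => unitaryM (f t) (g t)).
Proof. by move=> cf cg x; exact: cvg_unitaryM (cf x) (cg x). Qed.

Lemma continuous_unitaryV (T : topologicalType) (f : T -> U) :
  continuous f -> continuous (fun t => unitaryV (f t)).
Proof. by move=> cf x; exact: cvg_unitaryV (cf x). Qed.

Lemma unitary_entry_le1 (V : U) i j : rnorm ((\val V) i j : Cx R) <= 1.
Proof.
have /(congr1 (fun M : 'M[Cx R]_n => M i i)) := congr1 \val (unitaryMV V).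
rewrite /= !mxE eqxx => /(congr1 Re) /=.
have E k : (\val V) i k * ((\val V)^t* )%sesqui k i = ((rnorm ((\val V) i k : Cx R) ^+ 2)%:C)%C.
  by rewrite !mxE -normCK normE rmorphXn.
under eq_bigr do rewrite E.
rewrite -rmorph_sum /= (bigD1 j) //= => s1.
rewrite -(@ler_pXn2r _ 2) ?nnegrE ?rnorm_ge0 // expr1n -s1 lerDl.
by rewrite sumr_ge0 // => k _; rewrite sqr_ge0.
Qed.

(** Along an ultrafilter the real and imaginary parts of each entry stay in [-1, 1], hence converge;
    the limit matrix is unitary because V V^* = 1 is a closed condition. *)
Lemma compact_unitary : compact [set: U].
Proof.
rewrite compact_ultra => F FU _.
have FP : ProperFilter F by exact: ultra_proper.
have cvg1 (p : Cx R -> R) : (forall z, `|p z| <= rnorm z) -> forall i j,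
    exists r : R, (fun u : U => p ((\val u) i j)) @ F --> r.
  move=> pz i j.
  have := @segment_compact R (-1) 1.
  move=> /(_ ((fun u : U => p ((\val u) i j)) @ F) _).
  have h : ((fun u : U => p ((\val u) i j)) @ F) `[-1, 1]%classic.
    change (F [set u : U | p (\val u i j) \in `[-1, 1]]).
    apply: filterS filterT => u _; rewrite /= in_itv /= -ler_norml.
    exact: le_trans (pz _) (unitary_entry_le1 u i j).
  move=> /(_ h)[r [_ Fr]]; exists r => B rB.
  (* An ultrafilter converges to each of its cluster points: otherwise it contains the complement of
     the preimage of B, which r being a cluster point forbids. *)
  have [//|FB] := in_ultra_setVsetC ((fun u : U => p ((\val u) i j)) @^-1` B) FU.
  by have [x []] := Fr (~` B) B FB rB.
have [a Fa] := choice (fun ij => cvg1 _ (@norm_Re_le R) ij.1 ij.2).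
have [b Fb] := choice (fun ij => cvg1 _ (@norm_Im_le R) ij.1 ij.2).
pose M : 'M[Cx R]_n := \matrix_(i, j) Complex (a (i, j)) (b (i, j)).
have FM i j : (fun u : U => (\val u) i j) @ F --> M i j.
  by apply: cvg_complex; rewrite mxE; [exact: (Fa (i, j))|exact: (Fb (i, j))].
have Mu : M \in [set V : 'M[Cx R]_n | V \is unitarymx].
  apply/mem_set/unitarymxP/matrixP => i j.
  have : (fun u : U => ((\val u) *m ((\val u)^t* )%sesqui) i j) @ F --> (M *m (M^t* )%sesqui) i j.
    rewrite mxE.
    rewrite [X in X @ _ --> _](_ : _ =
      (fun u : U => \sum_k (\val u) i k * ((\val u) j k)^* )); last first.
      by apply/funext => u /=; rewrite !mxE; apply: eq_bigr => k _; rewrite !mxE.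
    apply: cvg_csum => k; apply: cvgM; first exact: FM.
    by rewrite 2!mxE; apply: cvg_conj; exact: FM.
  have -> : (fun u : U => ((\val u) *m ((\val u)^t* )%sesqui) i j) = cst ((1%:M : 'M[Cx R]_n) i j).
    apply/funext => u /=.
    by have /(congr1 (fun M : 'M[Cx R]_n => M i j)) := congr1 \val (unitaryMV u).
  by move=> h; have := cvg_unique _ h (@cvg_cst _ _ _ F _); apply.
exists (exist _ M Mu); split => //.
by apply: cvg_unitary => i j; exact: FM.
Qed.

End UnitaryTopology.

(** * Integrals of complex functions *)

Section Integral.
Variables (R : realType) (n : nat).
Local Notation U := (unitary_group R n).

Lemma open_unitary_measurable (A : set U) : open A -> measurable A.
Proof. by move=> oA; exact: sub_sigma_algebra. Qed.

Lemma continuous_unitary_measurable (f : U -> R) :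
  continuous f -> measurable_fun setT f.
Proof.
move=> /continuousP cf; apply: (measurability _ (RGenOpens.measurableE R)).
move=> _ [_ [a [b ->] <-]]; rewrite setTI.
by apply: open_unitary_measurable; apply: cf; exact: interval_open.
Qed.

Lemma continuous_unitary_measurableU (f : U -> U) :
  continuous f -> measurable_fun setT f.
Proof.
move=> /continuousP cf; apply: (@measurability _ _ _ _ _ _ (@open U)) => //.
by move=> _ [A oA <-]; rewrite setTI; apply: open_unitary_measurable; exact: cf.
Qed.

Lemma continuous_bounded (f : U -> R) : continuous f -> exists M, forall x, `|f x| <= M.
Proof.
move=> cf; have := compact_bounded (continuous_compact (continuous_subspaceT cf) (@compact_unitary R n)).
move=> [M [_ hM]]; exists (M + 1) => x; apply: (hM (M + 1)); first by rewrite ltrDl.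
by exists x.
Qed.

Variable mu : probability U R.
Local Notation cint := (cintegral mu).

Definition rintegrable (f : U -> R) := mu.-integrable setT (EFin \o f).

Lemma continuous_rintegrable (f : U -> R) : continuous f -> rintegrable f.
Proof.
move=> cf; apply: measurable_bounded_integrable => //.
- exact: (le_lt_trans (probability_le1 mu measurableT) (ltry 1)).
- exact: continuous_unitary_measurable.
have [M fM] := continuous_bounded cf; exists M; split; first exact: num_real.
by move=> x Mx y _ /=; exact: le_trans (fM y) (ltW Mx).
Qed.

Lemma Rintegral_constant (r : R) : \int[mu]_x r = r.
Proof.
transitivity (r * fine (mu setT)); first exact: Rintegral_cst.
by rewrite probability_setT mulr1.
Qed.

Definition cintegrable (f : U -> Cx R) :=
  rintegrable (Re \o f) /\ rintegrable (Im \o f).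

Implicit Types f g : U -> Cx R.

Lemma continuous_cintegrable f : continuous f -> cintegrable f.
Proof.
by move=> cf; split; apply: continuous_rintegrable; [exact: continuous_Re|exact: continuous_Im].
Qed.

Lemma rintegrableD (f g : U -> R) : rintegrable f -> rintegrable g ->
  rintegrable (fun x => f x + g x).
Proof. by move=> hf hg; exact: (integrableD _ hf hg). Qed.

Lemma rintegrableN (f : U -> R) : rintegrable f -> rintegrable (fun x => - f x).
Proof. by move=> hf; exact: (integrableN hf). Qed.

Lemma rintegrableZ a (f : U -> R) : rintegrable f -> rintegrable (fun x => a * f x).
Proof. by move=> hf; exact: (integrableZl _ a hf). Qed.

Lemma rintegrable_ext (f g : U -> R) : f =1 g -> rintegrable f -> rintegrable g.
Proof. by move=> /funext ->. Qed.

Lemma rintegrable_measurable (f : U -> R) : rintegrable f -> measurable_fun setT f.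
Proof. by move=> /integrableP[/measurable_EFinP]. Qed.

Lemma rintegrable_le (f g : U -> R) : measurable_fun setT f ->
  (forall x, `|f x| <= g x) -> rintegrable g -> rintegrable f.
Proof.
move=> mf fg ig; apply: le_integrable ig => //; first exact/measurable_EFinP.
by move=> x _ /=; rewrite lee_fin (le_trans (fg x)) // ler_norm.
Qed.

Lemma cintegrableD f g : cintegrable f -> cintegrable g -> cintegrable (f + g).
Proof.
move=> [rf mf] [rg mg]; split.
  by apply: rintegrable_ext (rintegrableD rf rg) => x /=; rewrite cReD.
by apply: rintegrable_ext (rintegrableD mf mg) => x /=; rewrite cImD.
Qed.

Lemma cintegrableZ a f : cintegrable f -> cintegrable (fun x => a * f x).
Proof.
move=> [rf mf]; split.
  apply: rintegrable_ext (rintegrableD (rintegrableZ (Re a) rf)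
    (rintegrableN (rintegrableZ (Im a) mf))) => x /=.
  by rewrite cReM.
apply: rintegrable_ext (rintegrableD (rintegrableZ (Re a) mf)
  (rintegrableZ (Im a) rf)) => x /=.
by rewrite cImM.
Qed.

Lemma cintegralD f g : cintegrable f -> cintegrable g ->
  cint (f + g) = cint f + cint g.
Proof.
move=> [rf mf] [rg mg]; rewrite /cintegral; apply: complex_ext => /=.
  rewrite -RintegralD //.
  by apply: eq_Rintegral => x _; rewrite cReD.
rewrite -RintegralD //.
by apply: eq_Rintegral => x _; rewrite cImD.
Qed.

Lemma cintegralZ a f : cintegrable f -> cint (fun x => a * f x) = a * cint f.
Proof.
move=> [rf mf]; rewrite /cintegral; apply: complex_ext.
  rewrite cReM /= -!RintegralZl // -RintegralB //; last 2 first.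
  - exact: rintegrableZ.
  - exact: rintegrableZ.
  by apply: eq_Rintegral => x _; rewrite cReM.
rewrite cImM /= -!RintegralZl // -RintegralD //; last 2 first.
- exact: rintegrableZ.
- exact: rintegrableZ.
by apply: eq_Rintegral => x _; rewrite cImM.
Qed.

Lemma cintegral_conj f : cintegrable f -> cint (fun x => (f x)^* ) = (cint f)^*.
Proof.
move=> [rf mf]; rewrite conjE /cintegral; congr Complex => /=.
  by apply: eq_Rintegral => x _; rewrite conjE.
rewrite -mulN1r -RintegralZl //.
by apply: eq_Rintegral => x _; rewrite conjE mulN1r.
Qed.

Lemma measurable_rnorm f : measurable_fun setT (Re \o f) -> measurable_fun setT (Im \o f) ->
  measurable_fun setT (fun x => rnorm (f x)).
Proof.
move=> rf mf.
have -> : (fun x => rnorm (f x)) =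
    Num.sqrt \o (fun x => (Re \o f) x ^+ 2 + (Im \o f) x ^+ 2).
  by apply/funext => x /=; rewrite -sqr_rnorm sqrtr_sqr ger0_norm ?rnorm_ge0.
apply: measurableT_comp.
  exact: continuous_measurable_fun (@sqrt_continuous R).
by apply: measurable_funD; exact: measurable_funX.
Qed.

Lemma cintegrable_rnorm f : cintegrable f -> rintegrable (fun x => rnorm (f x)).
Proof.
move=> [rf mf].
apply: rintegrable_le (rintegrableD (integrable_norm rf) (integrable_norm mf)).
  by apply: measurable_rnorm; exact: rintegrable_measurable.
by move=> x /=; rewrite ger0_norm ?rnorm_ge0 // rnorm_le.
Qed.

Lemma Rintegral_le (f g : U -> R) : rintegrable f -> rintegrable g ->
  (forall x, f x <= g x) -> \int[mu]_x f x <= \int[mu]_x g x.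
Proof. by move=> hf hg fg; apply: le_Rintegral. Qed.

(** Rotating the integral onto the nonnegative reals leaves a comparison of real integrands. *)
Lemma rnorm_cintegral_le f : cintegrable f ->
  rnorm (cint f) <= \int[mu]_x rnorm (f x).
Proof.
move=> hf; have [c c1 hc] := rotation (cint f).
have -> : rnorm (cint f) = Re (cint (fun x => c * f x)) by rewrite cintegralZ // hc.
apply: Rintegral_le.
- exact: (cintegrableZ c hf).1.
- exact: cintegrable_rnorm.
- by move=> x; rewrite (le_trans (Re_le _)) // rnormM c1 mul1r.
Qed.

End Integral.

(** * Haar measure *)

Section Haar.
Variables (R : realType) (n : nat) (mu : probability (unitary_group R n) R).
Local Notation U := (unitary_group R n).
Local Notation cint := (cintegral mu).

(** Common form of left and right translations; continuity supplies the measurability needed for the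
    change of variables. *)
Definition preserving (a : U -> U) :=
  continuous a /\ forall A : set U, measurable A -> mu (a @^-1` A) = mu A.

Lemma Rintegral_preserving (a : U -> U) (f : U -> R) :
  preserving a -> measurable_fun setT f ->
  \int[mu]_x f (a x) = \int[mu]_x f x.
Proof.
move=> [ca pa] mf; congr fine.
have ma := continuous_unitary_measurableU ca.
rewrite [RHS](@eq_measure_integral _ _ _ _ (pushforward mu a)); last first.
  by move=> A mA _; exact: esym (pa A mA).
rewrite integralE [RHS]integralE.
have mf' : measurable_fun setT (EFin \o f) by exact/measurable_EFinP.
congr (_ - _)%E; rewrite ge0_integral_pushforward //.
- by rewrite preimage_setT; apply: eq_integral => x _; rewrite unlock.
- exact: measurable_funepos.
- by rewrite preimage_setT; apply: eq_integral => x _; rewrite unlock.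
- exact: measurable_funeneg.
Qed.

Hypothesis haar : is_haar mu.

Lemma continuous_translL (V : U) : continuous (translL V).
Proof. exact: (@continuous_unitaryM _ _ _ (fun=> V) id (@cst_continuous _ _ V) (fun x A xA => xA)). Qed.

Lemma continuous_translR (V : U) : continuous (translR V).
Proof. exact: (@continuous_unitaryM _ _ _ id (fun=> V) (fun x A xA => xA) (@cst_continuous _ _ V)). Qed.

Lemma preserving_translL (V : U) : preserving (translL V).
Proof.
by split; [exact: continuous_translL|move=> A mA; exact: (haar V mA).1].
Qed.

Lemma preserving_translR (V : U) : preserving (translR V).
Proof.
by split; [exact: continuous_translR|move=> A mA; exact: (haar V mA).2].
Qed.

Lemma cintegral_preserving (a : U -> U) (f : U -> Cx R) :
  preserving a -> cintegrable mu f -> cint (f \o a) = cint f.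
Proof.
move=> pa [rf mf]; rewrite /cintegral; congr Complex.
  exact: (Rintegral_preserving pa (rintegrable_measurable rf)).
exact: (Rintegral_preserving pa (rintegrable_measurable mf)).
Qed.

(** By compactness finitely many translates of O cover the group; were O null, they would all be
    null and the total mass would be 0 instead of 1. *)
Lemma haar_open_gt0 (O : set U) (x : U) : open O -> O x -> (0 < mu O)%E.
Proof.
move=> oO Ox; rewrite lt0e measure_ge0 andbT; apply/eqP => O0.
have := @compact_unitary R n; rewrite compact_cover.
have oT (V : U) : open (translL V @^-1` O).
  by have /continuousP := @continuous_translL V; apply.
move=> /(_ U setT (fun V => translL V @^-1` O)) [||D _ UD].
- by move=> V _; exact: oT.
(* Translation by x y^-1 carries y to x, which lies in O. *)
- move=> y _; exists (unitaryM x (unitaryV y)) => //=.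
  by rewrite /translL -unitaryA unitaryVM unitaryM1.
have : mu (\big[setU/set0]_(V <- D) (translL V @^-1` O)) = 0%E.
  suff [] : measurable (\big[setU/set0]_(V <- D) (translL V @^-1` O)) /\
      mu (\big[setU/set0]_(V <- D) (translL V @^-1` O)) = 0%E by [].
  apply: (big_ind (fun A : set U => measurable A /\ mu A = 0%E)).
  - by rewrite measure0; split.
  - move=> A B [mA A0] [mB B0]; split; first exact: measurableU.
    have AB : (mu (A `|` B) <= mu A + mu B)%E := measureU2 mu mA mB.
    by apply/eqP; rewrite eq_le measure_ge0 andbT (le_trans AB) // A0 B0 adde0.
  move=> V _; split; first exact: open_unitary_measurable (oT V).
  by rewrite (haar V (open_unitary_measurable oO)).1.
have UE : \bigcup_(V in [set` D]) (translL V @^-1` O) = setT.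
  by apply/seteqP; split => // y /UD.
by rewrite -bigcup_fset UE probability_setT => /eqP; rewrite onee_eq0.
Qed.

(** If f x > 0, then f exceeds f x / 2 on an open set, which has positive measure. *)
Lemma Rintegral_continuous_eq0 (f : U -> R) : continuous f -> (forall x, 0 <= f x) ->
  \int[mu]_x f x = 0 -> forall x, f x = 0.
Proof.
move=> cf f0 If x; apply/eqP; rewrite eq_le f0 andbT leNgt; apply/negP => fx.
pose O := f @^-1` `]f x / 2, +oo[.
have oO : open O by move/continuousP: cf; apply; exact: rray_open.
have Ox : O x by rewrite /O /= in_itv /= andbT ltr_pdivrMr // mulr_natr mulr2n ltrDl.
have mO := open_unitary_measurable oO.
have : \int[mu]_y (f x / 2 * \1_O y) <= \int[mu]_y f y.
  apply: Rintegral_le.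
  - exact: (rintegrableZ _ (integrable_indic mu mO)).
  - exact: continuous_rintegrable.
  move=> y; rewrite indicE; have [/set_mem|_] := boolP (y \in O); last by rewrite mulr0.
  by rewrite /O /= in_itv /= andbT mulr1 => /ltW.
rewrite If RintegralZl //; last exact: (integrable_indic mu mO).
rewrite pmulr_rle0 ?divr_gt0 // leNgt => /negP; apply.
rewrite /Rintegral integral_indic // setIT fine_gt0 // (haar_open_gt0 oO Ox) /=.
exact: (le_lt_trans (probability_le1 mu mO) (ltry 1)).
Qed.

End Haar.

(** * Square integrable functions *)

Section L2.
Variables (R : realType) (n : nat) (mu : probability (unitary_group R n) R).
Local Notation U := (unitary_group R n).
Local Notation cint := (cintegral mu).
Local Notation L2 := (L2space mu).
Implicit Types f g h : U -> Cx R.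

Definition sqnorm f := \int[mu]_x rnorm (f x) ^+ 2.

Lemma L2_integrable f : L2 f -> rintegrable mu (fun x => rnorm (f x) ^+ 2).
Proof.
move=> [rf mf ff]; apply/integrableP; split.
  by apply/measurable_EFinP; apply: measurable_funX; exact: measurable_rnorm.
rewrite (eq_integral (fun x => (rnorm (f x) ^+ 2)%:E)) // => x _ /=.
by rewrite ger0_norm // sqr_ge0.
Qed.

Lemma sqnormE f : L2 f -> (\int[mu]_x (rnorm (f x) ^+ 2)%:E)%E = (sqnorm f)%:E.
Proof. by move=> hf; rewrite /sqnorm /Rintegral fineK // integrable_fin_num //; exact: L2_integrable. Qed.

Lemma sqnorm_ge0 f : 0 <= sqnorm f.
Proof. by apply: Rintegral_ge0 => x _; rewrite sqr_ge0. Qed.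

Lemma L2_intro f : measurable_fun setT (Re \o f) -> measurable_fun setT (Im \o f) ->
  rintegrable mu (fun x => rnorm (f x) ^+ 2) -> L2 f.
Proof.
move=> rf mf /integrableP[_ h]; split => //.
rewrite (eq_integral (fun x => `|((rnorm (f x) ^+ 2)%:E)|%E)) // => x _ /=.
by rewrite ger0_norm // sqr_ge0.
Qed.

Lemma continuous_L2 f : continuous f -> L2 f.
Proof.
move=> cf; apply: L2_intro.
- by apply: continuous_unitary_measurable; exact: continuous_Re.
- by apply: continuous_unitary_measurable; exact: continuous_Im.
by apply: continuous_rintegrable; exact: continuous_sqr_rnorm.
Qed.

Lemma L2_add f g : L2 f -> L2 g -> L2 (f + g).
Proof.
move=> hf hg; have [rf mf _] := hf; have [rg mg _] := hg.
have mr : measurable_fun setT (Re \o (f + g)).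
  rewrite (_ : _ \o _ = (Re \o f) \+ (Re \o g)); first exact: measurable_funD.
  by apply/funext => x /=; rewrite cReD.
have mi : measurable_fun setT (Im \o (f + g)).
  rewrite (_ : _ \o _ = (Im \o f) \+ (Im \o g)); first exact: measurable_funD.
  by apply/funext => x /=; rewrite cImD.
apply: L2_intro => //.
apply: rintegrable_le (rintegrableZ 2 (rintegrableD (L2_integrable hf) (L2_integrable hg))).
  by apply: measurable_funX; exact: measurable_rnorm.
move=> x; rewrite ger0_norm ?sqr_ge0 //=.
have := rnormD (f x) (g x); have := rnorm_ge0 (f x + g x).
rewrite -[(f + g) x]/(f x + g x).
move: (rnorm (f x + g x)) (rnorm (f x)) (rnorm (g x)) => a b c a0 abc.
have : a * a <= (b + c) * (b + c) by apply: ler_pM.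
by have := sqr_ge0 (b - c); nra.
Qed.

Lemma L2_scale (a : Cx R) f : L2 f -> L2 (a *: f).
Proof.
move=> hf; have [rf mf _] := hf.
apply: L2_intro.
- rewrite (_ : _ \o _ = (fun x => Re a * (Re \o f) x - Im a * (Im \o f) x)).
    by apply: measurable_funB; apply: measurable_funM => //; exact: measurable_cst.
  by apply/funext => x /=; rewrite -cReM.
- rewrite (_ : _ \o _ = (fun x => Re a * (Im \o f) x + Im a * (Re \o f) x)).
    by apply: measurable_funD; apply: measurable_funM => //; exact: measurable_cst.
  by apply/funext => x /=; rewrite -cImM.
apply: rintegrable_ext (rintegrableZ (rnorm a ^+ 2) (L2_integrable hf)) => x /=.
by rewrite -exprMn -rnormM.
Qed.

Lemma L2_sub f g : L2 f -> L2 g -> L2 (f - g).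
Proof. by move=> hf hg; rewrite -scaleN1r; apply: L2_add => //; exact: L2_scale. Qed.

Lemma L2_mul f g : L2 f -> L2 g -> cintegrable mu (fun x => f x * (g x)^* ).
Proof.
move=> hf hg; have [rf mf _] := hf; have [rg mg _] := hg.
have bnd x : rnorm (f x * (g x)^* ) <= rnorm (f x) ^+ 2 + rnorm (g x) ^+ 2.
  rewrite rnormM rnormJ.
  by have := sqr_ge0 (rnorm (f x) - rnorm (g x)); have := sqr_ge0 (rnorm (f x) + rnorm (g x)); nra.
have i := rintegrableD (L2_integrable hf) (L2_integrable hg).
split; apply: rintegrable_le i.
- rewrite (_ : _ \o _ = (fun x => (Re \o f) x * (Re \o g) x + (Im \o f) x * (Im \o g) x)).
    by apply: measurable_funD; exact: measurable_funM.
  by apply/funext => x /=; rewrite cReM conjE /= mulrN opprK.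
- by move=> x; exact: le_trans (norm_Re_le _) (bnd x).
- rewrite (_ : _ \o _ = (fun x => (Im \o f) x * (Re \o g) x - (Re \o f) x * (Im \o g) x)).
    by apply: measurable_funB; exact: measurable_funM.
  by apply/funext => x /=; rewrite cImM conjE /= mulrN addrC.
- by move=> x; exact: le_trans (norm_Im_le _) (bnd x).
Qed.

Lemma L2innerD f g h : L2 f -> L2 g -> L2 h ->
  L2inner mu (f + g) h = L2inner mu f h + L2inner mu g h.
Proof.
move=> hf hg hh; rewrite /L2inner -cintegralD; try exact: L2_mul.
by congr (cintegral mu _); apply/funext => x; rewrite /GRing.add /= mulrDl.
Qed.

Lemma L2innerZ a f h : L2 f -> L2 h -> L2inner mu (a *: f) h = a * L2inner mu f h.
Proof.
move=> hf hh; rewrite /L2inner -cintegralZ; last exact: L2_mul.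
by congr (cintegral mu _); apply/funext => x; rewrite mulrA.
Qed.

Lemma L2inner_conj f h : L2 f -> L2 h -> (L2inner mu f h)^* = L2inner mu h f.
Proof.
move=> hf hh; rewrite /L2inner -cintegral_conj; last exact: L2_mul.
by congr (cintegral mu _); apply/funext => x; rewrite rmorphM /= conjCK mulrC.
Qed.

Lemma L2innerB f g h : L2 f -> L2 g -> L2 h ->
  L2inner mu (f - g) h = L2inner mu f h - L2inner mu g h.
Proof.
by move=> hf hg hh; rewrite -scaleN1r L2innerD ?L2innerZ ?mulN1r //; exact: L2_scale.
Qed.

Lemma L2inner_sqnorm f : L2inner mu f f = ((sqnorm f)%:C)%C.
Proof.
rewrite /L2inner /cintegral; congr Complex.
  by apply: eq_Rintegral => x _; rewrite -normCK normE -rmorphXn.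
rewrite (@eq_Rintegral _ _ _ _ _ (cst 0)).
  by rewrite Rintegral_cst // mul0r.
by move=> x _; rewrite -normCK normE -rmorphXn.
Qed.

Lemma L2_0 : L2 0.
Proof. by apply: continuous_L2; exact: cst_continuous. Qed.

Lemma L2_sum (I : Type) (r : seq I) (P : pred I) (F : I -> U -> Cx R) :
  (forall i, P i -> L2 (F i)) -> L2 (\sum_(i <- r | P i) F i).
Proof.
by move=> hF; apply: (big_ind L2) => //; [exact: L2_0|exact: L2_add].
Qed.

Lemma L2inner0 h : L2 h -> L2inner mu 0 h = 0.
Proof.
by move=> hh; have := L2innerZ 0 hh hh; rewrite scale0r mul0r.
Qed.

Lemma sqnorm0 : sqnorm 0 = 0.
Proof. by apply: complexI; rewrite -L2inner_sqnorm L2inner0 //; exact: L2_0. Qed.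

Lemma L2inner_sum (I : Type) (r : seq I) (P : pred I) (F : I -> U -> Cx R) h :
  L2 h -> (forall i, P i -> L2 (F i)) ->
  L2inner mu (\sum_(i <- r | P i) F i) h = \sum_(i <- r | P i) L2inner mu (F i) h.
Proof.
move=> hh hF; elim: r => [|i r IH]; first by rewrite !big_nil L2inner0.
rewrite !big_cons; case: ifP => // Pi; rewrite L2innerD ?IH //; first exact: hF.
exact: L2_sum.
Qed.

End L2.

(** * Completeness of the space of square integrable functions *)

Section Completeness.
Variables (R : realType) (n : nat) (mu : probability (unitary_group R n) R).
Local Notation U := (unitary_group R n).
Local Notation L2 := (L2space mu).
Local Notation sqn := (sqnorm mu).

Lemma geometric_cauchy_cvg (u : R^nat) (c : R) :
  (forall k, `|u k.+1 - u k| <= c * 2^-1 ^+ k) -> cvgn u.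
Proof.
move=> uc; have -> : u = (fun k => u 0%N + series (telescope u) k).
  by apply/funext => k; exact: eq_sum_telescope.
apply: is_cvgD; first exact: is_cvg_cst.
apply: normed_cvg; apply: (@series_le_cvg _ _ (geometric c 2^-1)).
- by move=> k /=.
- by move=> k; exact: le_trans (uc k).
- by move=> k; exact: uc.
by apply: is_cvg_geometric_series; rewrite ger0_norm ?invr_ge0 // invf_lt1 // ltr1n.
Qed.

Lemma limn_einf_le (u : (\bar R)^nat) (c : \bar R) :
  (forall k, (u k <= c)%E) -> (limn_einf u <= c)%E.
Proof.
move=> uc; rewrite limn_einf_lim; apply: lime_le; first exact: is_cvg_einfs.
apply: nearW => k; apply: le_trans (uc k).
by apply: ereal_inf_lbound; exists k => /=.
Qed.

Lemma sqnorm_add f g : L2 f -> L2 g -> sqn (f + g) <= 2 * sqn f + 2 * sqn g.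
Proof.
move=> hf hg; rewrite -mulrDr /sqnorm -RintegralD //; try exact: L2_integrable.
rewrite -RintegralZl //; last by apply: rintegrableD; exact: L2_integrable.
apply: Rintegral_le; first exact: (L2_integrable (L2_add hf hg)).
  by apply: rintegrableZ; apply: rintegrableD; exact: L2_integrable.
move=> x.
have := rnormD (f x) (g x); have := rnorm_ge0 (f x + g x).
rewrite -[(f + g) x]/(f x + g x).
move: (rnorm (f x + g x)) (rnorm (f x)) (rnorm (g x)) => a b c a0 abc.
have : a * a <= (b + c) * (b + c) by apply: ler_pM.
by have := sqr_ge0 (b - c); nra.
Qed.

Lemma fine_limn_esup_cvg (u : R^nat) : cvgn u ->
  u @ \oo --> fine (limn_esup (fun k => (u k)%:E)).
Proof.
move=> cu; have : (fun k => (u k)%:E) @ \oo --> (limn u)%:E by apply: cvg_EFin => //; exact: nearW.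
by move/cvg_limn_einf_sup => ->.
Qed.

(** Riesz-Fischer with an explicit rate. The decay of t by 16 leaves room for the weights 4^k that
    force pointwise convergence almost everywhere; Fatou's lemma then gives the error bound. *)
Lemma L2_complete (s : nat -> U -> Cx R) (t : nat -> R) :
  (forall k, L2 (s k)) -> (forall k, t k.+1 <= t k / 16) -> (forall k, 0 <= t k) ->
  (forall k, sqn (s k.+1 - s k) <= t k) ->
  exists2 g, L2 g & forall k, sqn (g - s k) <= 4 * t k.
Proof.
move=> Ls t16 t0 st.
have Ld i j : L2 (s i - s j) by exact: L2_sub.
have mRe i : measurable_fun setT (Re \o s i) by have [] := Ls i.
have mIm i : measurable_fun setT (Im \o s i) by have [] := Ls i.
(* Where H is finite, successive differences are O(2^-k). Its integral is finite because 4^k t_k <=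
   t_0 (4/16)^k, which is compared with t_0 2^-k. *)
pose H x := (\sum_(0 <= k <oo) (4 ^+ k * rnorm (s k.+1 x - s k x) ^+ 2)%:E)%E.
have mH1 k : measurable_fun setT (fun x => (4 ^+ k * rnorm (s k.+1 x - s k x) ^+ 2)%:E).
  apply/measurable_EFinP; apply: rintegrable_measurable.
  exact: (rintegrableZ _ (L2_integrable (Ld k.+1 k))).
have H0 k x : (0 <= (4 ^+ k * rnorm (s k.+1 x - s k x) ^+ 2)%:E)%E.
  by rewrite lee_fin mulr_ge0 ?sqr_ge0 ?exprn_ge0 // ler0n.
have tk k : t k <= t 0%N * 16^-1 ^+ k.
  elim: k => [|k IH]; first by rewrite expr0 mulr1.
  by rewrite (le_trans (t16 k)) // exprSr mulrA ler_pM2r.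
have iH : mu.-integrable setT H.
  apply/integrableP; split.
    by apply: ge0_emeasurable_sum => [k x _ _|k _]; [exact: H0|exact: mH1].
  rewrite (eq_integral H); last first.
    by move=> x _; rewrite gee0_abs //; apply: nneseries_ge0 => k _ _; exact: H0.
  rewrite integral_nneseries //.
  apply: (@le_lt_trans _ _ (\sum_(0 <= k <oo) (t 0%N * 2^-1 ^+ k)%:E)%E).
    apply: lee_nneseries => k _.
      by move=> _; apply: integral_ge0 => x _; exact: H0.
    have -> : (\int[mu]_x (4 ^+ k * rnorm (s k.+1 x - s k x) ^+ 2)%:E)%E =
        (4 ^+ k * sqn (s k.+1 - s k))%:E.
      rewrite -RintegralZl //; last exact: L2_integrable.
      rewrite /Rintegral fineK //; apply: integrable_fin_num => //.
      exact: (rintegrableZ _ (L2_integrable (Ld k.+1 k))).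
    rewrite lee_fin.
    apply: (@le_trans _ _ (4 ^+ k * (t 0%N * 16^-1 ^+ k))).
      by rewrite ler_wpM2l ?exprn_ge0 // (le_trans (st k)).
    have q : (4 * 16^-1 : R) <= 2^-1 by lra.
    by rewrite mulrCA -exprMn ler_wpM2l // lerXn2r // nnegrE ?mulr_ge0 ?invr_ge0.
  have := @is_cvg_geometric_series R (t 0%N) 2^-1.
  rewrite ger0_norm ?invr_ge0 // invf_lt1 // ltr1n => /(_ isT) c.
  rewrite (_ : limn _ = (limn (series (geometric (t 0%N) 2^-1)))%:E) ?ltry //.
  rewrite -EFin_lim //; congr (limn _); apply/funext => k /=.
  by rewrite /series /= sumEFin.
(* Upper limits keep [g] measurable at the points where [s] diverges. *)
pose g x : Cx R := Complex (fine (limn_esup (fun k => (Re (s k x))%:E)))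
                           (fine (limn_esup (fun k => (Im (s k x))%:E))).
have mg (p : Cx R -> R) : (forall i, measurable_fun setT (p \o s i)) ->
    measurable_fun setT (fun x => fine (limn_esup (fun k => (p (s k x))%:E))).
  move=> mp; apply: measurableT_comp; first exact: (fine_measurable measurableT).
  by apply: measurable_fun_limn_esup => k; apply/measurable_EFinP; exact: (mp k).
have mgR := mg _ mRe.
have mgI := mg _ mIm.
have good x : H x \is a fin_num -> (fun k => s k x) @ \oo --> g x.
  move=> Hx.
  (* With y = 2^k |s_(k+1) x - s_k x|, the bound y^2 <= H x gives y <= H x + 1, since y <= y^2 + 1;
     no square root is needed. *)
  have dx k : rnorm (s k.+1 x - s k x) <= (fine (H x) + 1) * 2^-1 ^+ k.
    have : (4 ^+ k * rnorm (s k.+1 x - s k x) ^+ 2) <= fine (H x).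
      rewrite -lee_fin fineK //.
      apply: le_trans (nneseries_lim_ge k.+1 _); last by move=> i _ _; exact: H0.
      rewrite big_nat_recr //= leeDr //.
      by apply: sume_ge0 => i _; exact: H0.
    rewrite exprVn ler_pdivlMr ?exprn_gt0 //.
    have -> : (4 : R) ^+ k = (2 ^+ k) ^+ 2 by rewrite -exprM mulnC exprM; congr (_ ^+ k); ring.
    rewrite -exprMn [X in _ -> X <= _]mulrC.
    move: (2 ^+ k * _) => y y2.
    have := sqr_ge0 (y - 1); have := sqr_ge0 y; nra.
  apply: cvg_complex; apply: fine_limn_esup_cvg; apply: (@geometric_cauchy_cvg _ (fine (H x) + 1)) => k.
    by apply: le_trans (dx k); rewrite -cReN -cReD norm_Re_le.
  by apply: le_trans (dx k); rewrite -cImN -cImD norm_Im_le.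
(* The constant 4 survives the induction: 2 (4 t_(k+1)) + 2 t_k <= (8/16 + 2) t_k. *)
have tail k m : sqn (s (m + k)%N - s k) <= 4 * t k.
  elim: m k => [|m IH] k.
    by rewrite add0n subrr sqnorm0 mulr_ge0.
  have -> : s (m.+1 + k)%N - s k = (s (m + k.+1)%N - s k.+1) + (s k.+1 - s k).
    by rewrite addSnnS subrKA.
  apply: le_trans (sqnorm_add (Ld _ _) (Ld _ _)) _.
  by have := IH k.+1; have := t16 k; have := st k; have := t0 k; lra.
have mgr k : measurable_fun setT (Re \o (g - s k)).
  rewrite (_ : _ \o _ = (Re \o g) \- (Re \o s k)); first exact: measurable_funB.
  by apply/funext => x /=; rewrite cReD cReN.
have mgi k : measurable_fun setT (Im \o (g - s k)).
  rewrite (_ : _ \o _ = (Im \o g) \- (Im \o s k)); first exact: measurable_funB.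
  by apply/funext => x /=; rewrite cImD cImN.
have mgs k := measurable_rnorm (mgr k) (mgi k).
(* Almost everywhere the integrand is the limit of [F m x] in m, so Fatou's lemma carries the bound
   [tail], uniform in m, to the limit. *)
have main k : (\int[mu]_x (rnorm (g x - s k x) ^+ 2)%:E <= (4 * t k)%:E)%E.
  pose F m x := (rnorm (s (m + k)%N x - s k x) ^+ 2)%:E : \bar R.
  have mF m : measurable_fun setT (F m).
    apply/measurable_EFinP; exact: rintegrable_measurable (L2_integrable (Ld (m + k)%N k)).
  rewrite (ae_eq_integral (fun x => limn_einf (F^~ x))) //.
  - apply: le_trans (fatou mu measurableT mF _) _.
      by move=> m x _; rewrite lee_fin sqr_ge0.
    apply: limn_einf_le => m; rewrite /F.
    have := sqnormE (Ld (m + k)%N k); rewrite /GRing.add /= => ->.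
    by rewrite lee_fin; exact: tail.
  - by apply/measurable_EFinP; exact: (measurable_funX 2 (mgs k)).
  - rewrite /limn_einf; apply: measurableT_comp => //.
    by apply: measurable_fun_limn_esup => m; exact: measurableT_comp.
  - apply: filterS (integrable_ae measurableT iH) => x /(_ I) /good gx _.
    apply/esym; apply: (fst (cvg_limn_einf_sup _)).
    rewrite /F; apply: cvg_EFin; first exact: nearW.
    have c : (fun m => s (m + k)%N x - s k x) @ \oo --> g x - s k x.
      apply: cvgB; last exact: cvg_cst.
      by move: gx; rewrite -(cvg_shiftn k).
    have c1 := cvg_rnorm _ c; exact: cvgM (c1 _) (c1 _).
have Lgs k : L2 (g - s k).
  by split; [exact: mgr|exact: mgi|exact: le_lt_trans (main k) (ltry _)].
exists g; first by rewrite -(subrK (s 0%N) g); exact: L2_add.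
by move=> k; rewrite -lee_fin -sqnormE //; exact: main.
Qed.

End Completeness.

(** * Finite dimension of a closed space of continuous functions *)

Section FiniteDimension.
Variables (R : realType) (n : nat) (mu : probability (unitary_group R n) R).
Local Notation U := (unitary_group R n).
Local Notation L2 := (L2space mu).
Local Notation sqn := (sqnorm mu).
Variable S : set (U -> Cx R).
Hypothesis haar : is_haar mu.
Hypothesis subS : is_subspace S.
Hypothesis SC : S `<=` @Cspace R n.
Hypothesis closedS : L2closed mu S.

Lemma subset_L2 f : S f -> L2 f.
Proof. by move=> /SC; exact: continuous_L2. Qed.

Lemma subspaceD f g : S f -> S g -> S (f + g).
Proof. by move=> Sf Sg; have := subS.2 1 f g Sf Sg; rewrite scale1r. Qed.

Lemma subspaceZ a f : S f -> S (a *: f).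
Proof. by move=> Sf; have := subS.2 a f 0 Sf subS.1; rewrite addr0. Qed.

Lemma subspaceB f g : S f -> S g -> S (f - g).
Proof. by move=> Sf Sg; rewrite -scaleN1r; apply: subspaceD => //; exact: subspaceZ. Qed.

Lemma subspace_sum (I : Type) (r : seq I) (P : pred I) (F : I -> U -> Cx R) :
  (forall i, P i -> S (F i)) -> S (\sum_(i <- r | P i) F i).
Proof. by move=> hF; apply: (big_ind S) => //; [exact: subS.1|exact: subspaceD]. Qed.

Lemma open_superlevel (T : topologicalType) (f : T -> R) c :
  continuous f -> open [set x | c < f x].
Proof.
move=> /continuousP/(_ _ (rray_open c)); rewrite (_ : _ @^-1` _ = [set x | c < f x]) //.
by apply/seteqP; split => y /=; rewrite in_itv /= andbT.
Qed.

Lemma sqnormZ a f : L2 f -> sqn (a *: f) = rnorm a ^+ 2 * sqn f.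
Proof.
move=> hf; rewrite /sqnorm -RintegralZl //; last exact: L2_integrable.
by apply: eq_Rintegral => x _; rewrite -exprMn -rnormM.
Qed.

Lemma sqnorm_eq0 f : continuous f -> sqn f = 0 -> f = 0.
Proof.
move=> cf f0; apply/funext => x; apply: rnorm_eq0; apply/eqP; rewrite -sqrf_eq0.
apply/eqP; apply: (Rintegral_continuous_eq0 haar (continuous_sqr_rnorm cf)) => // y.
exact: sqr_ge0.
Qed.

(** A violation of the bound with C = (|M| + 1)^2 / e is rescaled so that its value at x has modulus
    |M| + 1; the squared norm then drops below e. *)
Lemma unbounded_small :
  ~ (exists C, forall f x, S f -> rnorm (f x) ^+ 2 <= C * sqn f) ->
  forall (M e : R), 0 < e -> exists f x, [/\ S f, M < rnorm (f x) & sqn f <= e].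
Proof.
move=> nC M e e0.
have : exists f x, S f /\ (`|M| + 1) ^+ 2 / e * sqn f < rnorm (f x) ^+ 2.
  apply: contra_notP nC => nf; exists ((`|M| + 1) ^+ 2 / e) => f x Sf.
  by rewrite leNgt; apply/negP => h; apply: nf; exists f, x.
move=> [f [x [Sf fx]]].
have M1 : 0 < `|M| + 1 by rewrite ltr_wpDl.
have fx0 : 0 < rnorm (f x).
  rewrite lt0r rnorm_ge0 andbT; apply: contraTneq fx => ->.
  rewrite expr0n /= -leNgt mulr_ge0 ?sqnorm_ge0 // divr_ge0 ?sqr_ge0 // ltW //.
pose a := (`|M| + 1) / rnorm (f x).
have a0 : 0 <= a by rewrite divr_ge0 ?rnorm_ge0 // ltW.
exists ((a%:C)%C *: f), x; split; first exact: subspaceZ.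
  rewrite -[(_ *: f) x]/(((a%:C)%C : Cx R) * f x) rnormM rnormr ger0_norm //.
  by rewrite /a divfK ?gt_eqF // (le_lt_trans (ler_norm M)) // ltrDl.
rewrite sqnormZ ?rnormr; last exact: subset_L2.
rewrite ger0_norm // /a expr_div_n.
move: fx; rewrite mulrAC ltr_pdivrMr // => /ltW h.
by rewrite mulrAC ler_pdivrMr ?exprn_gt0 // [e * _]mulrC.
Qed.

Lemma continuous_complex_bounded (f : U -> Cx R) : continuous f -> exists M, forall x, rnorm (f x) <= M.
Proof.
move=> /continuous_rnorm /continuous_bounded[M hM]; exists M => x.
exact: le_trans (ler_norm _) (hM x).
Qed.

(** This is the equivalence of the supremum and L_2 norms on S that the open mapping theorem would
    give, proved here by a direct construction. *)
Lemma sup_le_L2 : exists C, forall f x, S f -> rnorm (f x) ^+ 2 <= C * sqn f.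
Proof.
apply: contrapT => /unbounded_small big.
pose above (k : nat) (s : U -> Cx R) := [set x | k%:R < rnorm (s x)].
pose st := {p : (U -> Cx R) * R | S p.1 /\ 0 < p.2}.
(* A state pairs a function of S with the squared distance allowed for the next step. The last
   condition makes the set above height k larger in measure than the total remaining squared error,
   at most four times that tolerance. *)
have step (kp : nat * st) : exists q : st,
    [/\ (sval q).2 <= (sval kp.2).2 / 16,
        sqn ((sval q).1 - (sval kp.2).1) <= (sval kp.2).2 &
        ((4 * (sval q).2)%:E < mu (above kp.1 (sval q).1))%E].
  case: kp => k [[s t] [/= Ss t0]].
  have [M sM] := continuous_complex_bounded (SC Ss).
  (* As M bounds s, adding f lifts the modulus at x above k. *)
  have [f [x [Sf fx ft]]] := big (M + k%:R) t t0.
  pose O := above k (s + f).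
  have oO : open O.
    have cf : continuous (s + f) by apply: SC; exact: subspaceD.
    by apply: open_superlevel; exact: continuous_rnorm.
  have Ox : O x.
    rewrite /O /above /= -[(s + f) x]/(s x + f x).
    have := rnormD (s x + f x) (- s x); rewrite addrAC subrr add0r rnormN.
    by have := sM x; lra.
  have := haar_open_gt0 haar oO Ox.
  have Ofin : mu O \is a fin_num by apply: fin_num_measure; exact: open_unitary_measurable.
  rewrite -(fineK Ofin) lte_fin => m0.
  (* The first term is the decay required by [L2_complete]; the second makes four times the
     tolerance at most half of mu O. *)
  have t'0 : 0 < Num.min (t / 16) (fine (mu O) / 8) by rewrite lt_min !divr_gt0.
  exists (exist _ (s + f, Num.min (t / 16) (fine (mu O) / 8)) (conj (subspaceD Ss Sf) t'0)).
  split => /=.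
  - by rewrite ge_min lexx.
  - by rewrite addrAC subrr add0r.
  rewrite -/O -(fineK Ofin) lte_fin.
  have : Num.min (t / 16) (fine (mu O) / 8) <= fine (mu O) / 8 by rewrite ge_min lexx orbT.
  by move: m0; move: (fine _) (Num.min _ _) => m t'; lra.
(* Gliding hump: the next steps are so small that the limit keeps modulus at least
   [k - 1] somewhere on the set where [s] exceeds [k]. *)
have [next nextP] := choice step.
have init : S (0, 1 : R).1 /\ 0 < (0 : U -> Cx R, 1 : R).2 by split => //; exact: subS.1.
pose q := fix q k : st := if k is j.+1 then next (j, q j) else exist _ (0, 1) init.
have qP k : [/\ (sval (q k.+1)).2 <= (sval (q k)).2 / 16,
        sqn ((sval (q k.+1)).1 - (sval (q k)).1) <= (sval (q k)).2 &
        ((4 * (sval (q k.+1)).2)%:E < mu (above k (sval (q k.+1)).1))%E].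
  exact: (nextP (k, q k)).
have qS k : S (sval (q k)).1 by case: (q k) => -[s t] [].
have q0 k : 0 < (sval (q k)).2 by case: (q k) => -[s t] [].
have [g Lg gq] := @L2_complete _ _ mu (fun k => (sval (q k)).1) (fun k => (sval (q k)).2)
  (fun k => subset_L2 (qS k)) (fun k => let: And3 h _ _ := qP k in h) (fun k => ltW (q0 k))
  (fun k => let: And3 _ h _ := qP k in h).
have tq k : (sval (q k)).2 <= 16^-1 ^+ k.
  elim: k => [|k IH]; first by rewrite expr0.
  have [h _ _] := qP k; apply: (le_trans h).
  by rewrite exprSr ler_pM2r.
have [h [Sh gh]] : exists h, S h /\ {ae mu, forall V, g V = h V}.
  apply: closedS => // e e0.
  have [k ke] : exists k, 4 * (16^-1 ^+ k) < e.
    have : (fun k => 16^-1 ^+ k : R) @ \oo --> 0.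
      by apply: cvg_expr; rewrite ger0_norm ?invr_ge0 // invf_lt1 // ltr1n.
    move=> /cvgrPdist_lt /(_ (e / 4)); rewrite divr_gt0 // => /(_ isT) [k _ /(_ k (leqnn k))].
    rewrite /= sub0r normrN ger0_norm ?exprn_ge0 ?invr_ge0 // => ke.
    by exists k; lra.
  exists (sval (q k)).1; split => //.
  have := sqnormE (L2_sub Lg (subset_L2 (qS k))); rewrite /GRing.add /GRing.opp /= => ->.
  rewrite lte_fin; apply: le_lt_trans (gq k) _.
  by have := tq k; lra.
have [M hM] := continuous_complex_bounded (SC Sh).
(* The state [q k.+1] was built at height k. Where its function s exceeds k >= M + 1 in modulus, |h
   - s| >= 1; so this set has measure at most sqn (h - s) = sqn (g - s), contradicting the choice of
   tolerance. *)
have [k Mk] : exists k : nat, M + 1 <= k%:R.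
  exists (Num.bound `|M + 1|); rewrite (le_trans (ler_norm _)) // ltW // archi_boundP //.
have [_ _] := qP k; apply/negP; rewrite -leNgt.
set s := (sval (q k.+1)).1.
pose O := above k s.
have oO : open O.
  by apply: open_superlevel; apply: continuous_rnorm; exact: (SC (qS k.+1)).
have mO := open_unitary_measurable oO.
have E : sqn (h - s) = sqn (g - s).
  rewrite /sqnorm /Rintegral; congr fine; apply: ae_eq_integral => //.
  - by apply/measurable_EFinP; exact: rintegrable_measurable (L2_integrable (L2_sub (subset_L2 Sh) (subset_L2 (qS k.+1)))).
  - by apply/measurable_EFinP; exact: rintegrable_measurable (L2_integrable (L2_sub Lg (subset_L2 (qS k.+1)))).
  apply: filterS gh => x ghx _ /=.
  by rewrite -[(h - s) x]/(h x - s x) -ghx.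
apply: (@le_trans _ _ (sqn (h - s))%:E); last by rewrite lee_fin E; exact: gq.
rewrite -sqnormE; last exact: L2_sub (subset_L2 Sh) (subset_L2 (qS k.+1)).
apply: (@le_trans _ _ (\int[mu]_x (\1_O x)%:E)%E); first by rewrite integral_indic // setIT.
apply: ge0_le_integral => //.
- by apply/measurable_EFinP; exact: rintegrable_measurable (integrable_indic mu mO).
- by apply/measurable_EFinP; exact: rintegrable_measurable (L2_integrable (L2_sub (subset_L2 Sh) (subset_L2 (qS k.+1)))).
move=> x _; rewrite lee_fin indicE; have [/set_mem|_] := boolP (x \in O); last exact: sqr_ge0.
rewrite /O /above /= => sx.
have : 1 <= rnorm (h x - s x).
  have := rnorm_dist (s x) (h x); rewrite -(rnormN (s x - h x)) opprB.
  by have := ler_norm (rnorm (s x) - rnorm (h x)); have := hM x; lra.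
by move=> h1; rewrite -[leLHS](expr1n _ 2) lerXn2r // nnegrE ?rnorm_ge0.
Qed.

End FiniteDimension.

(** * Finite orthonormal bases *)

Section Basis.
Variables (R : realType) (n : nat) (mu : probability (unitary_group R n) R).
Local Notation U := (unitary_group R n).
Local Notation L2 := (L2space mu).
Local Notation sqn := (sqnorm mu).
Local Notation inner := (L2inner mu).
Variable S : set (U -> Cx R).
Hypothesis haar : is_haar mu.
Hypothesis subS : is_subspace S.
Hypothesis SC : S `<=` @Cspace R n.

Definition orthonormal_in k (e : nat -> U -> Cx R) :=
  (forall i, (i < k)%N -> S (e i)) /\
  (forall i j, (i < k)%N -> (j < k)%N -> inner (e i) (e j) = (i == j)%:R).

Definition combination k (e : nat -> U -> Cx R) (c : nat -> Cx R) : U -> Cx R :=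
  \sum_(i < k) c i *: e i.

Lemma combinationE k e c x : combination k e c x = \sum_(i < k) c i * e i x.
Proof. by rewrite /combination fct_sumE. Qed.

Lemma combination_in k e c : (forall i, (i < k)%N -> S (e i)) -> S (combination k e c).
Proof.
by move=> eS; apply: (subspace_sum subS) => i _; apply: (subspaceZ subS); exact: eS.
Qed.

Lemma inner_combination k e c f : L2 f -> (forall i, (i < k)%N -> S (e i)) ->
  inner (combination k e c) f = \sum_(i < k) c i * inner (e i) f.
Proof.
move=> hf eS; rewrite /combination L2inner_sum //.
  by apply: eq_bigr => i _; rewrite L2innerZ //; apply: (subset_L2 mu SC); exact: eS.
by move=> i _; apply: L2_scale; apply: (subset_L2 mu SC); exact: eS.
Qed.

Lemma inner_combination_basis k e c j : orthonormal_in k e -> (j < k)%N ->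
  inner (combination k e c) (e j) = c j.
Proof.
move=> [eS eo] jk; rewrite inner_combination //; last by apply: (subset_L2 mu SC); exact: eS.
rewrite (bigD1 (Ordinal jk)) //= eo // eqxx mulr1 big1 ?addr0 // => i.
by rewrite -val_eqE /= => ij; rewrite eo // (negbTE ij) mulr0.
Qed.

Lemma sqnorm_combination k e c : orthonormal_in k e ->
  sqn (combination k e c) = \sum_(i < k) rnorm (c i) ^+ 2.
Proof.
move=> eo; have eS := eo.1; apply: complexI; rewrite -L2inner_sqnorm.
have hc : L2 (combination k e c) by apply: (subset_L2 mu SC); exact: combination_in.
rewrite inner_combination // rmorph_sum /=; apply: eq_bigr => i _.
rewrite -L2inner_conj //; last by apply: (subset_L2 mu SC); exact: eS.
by rewrite inner_combination_basis // -normCK normE rmorphXn.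
Qed.

(** For A = sum_i |e_i x|^2, the bound tested at x on sum_i conj (e_i x) e_i reads A^2 <= C A, hence
    A <= |C|. Integrating A over a probability space gives k. *)
Lemma orthonormal_size C : (forall f x, S f -> rnorm (f x) ^+ 2 <= C * sqn f) ->
  forall k e, orthonormal_in k e -> k%:R <= `|C|.
Proof.
move=> hC k e eo; have eS := eo.1.
have bnd x : \sum_(i < k) rnorm (e i x) ^+ 2 <= `|C|.
  set A := \sum_(i < k) _.
  have := hC (combination k e (fun i => (e i x)^* )) x (combination_in _ eS).
  rewrite sqnorm_combination // combinationE.
  under eq_bigr do rewrite mulrC -normCK normE -rmorphXn.
  under [X in _ * X]eq_bigr do rewrite rnormJ.
  rewrite -rmorph_sum /= -/A rnormr.
  have A0 : 0 <= A by apply: sumr_ge0 => i _; exact: sqr_ge0.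
  rewrite ger0_norm // => AC.
  have [->|An] := eqVneq A 0; first exact: normr_ge0.
  apply: (le_trans _ (ler_norm C)).
  by rewrite -(@ler_pM2r _ A) ?lt0r ?An // -expr2.
have -> : k%:R = \int[mu]_x \sum_(i < k) rnorm (e i x) ^+ 2.
  transitivity (\sum_(i < k) sqn (e i)).
    rewrite (eq_bigr (fun=> 1)) ?sumr_const ?card_ord // => i _.
    by apply: complexI; rewrite -L2inner_sqnorm eo.2 // eqxx.
  have : forall m, (m <= k)%N -> rintegrable mu (fun x => \sum_(i < m) rnorm (e i x) ^+ 2) /\
      \sum_(i < m) sqn (e i) = \int[mu]_x \sum_(i < m) rnorm (e i x) ^+ 2.
    elim=> [_|m IH mk].
      have -> : (fun x => \sum_(i < 0) rnorm (e i x) ^+ 2) = cst 0 by apply/funext => x; rewrite big_ord0.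
      split; first by apply: continuous_rintegrable; exact: cst_continuous.
      by rewrite big_ord0 Rintegral_cst // mul0r.
    have [i1 e1] := IH (ltnW mk).
    have i2 := L2_integrable (subset_L2 mu SC (eS m mk)).
    have -> : (fun x => \sum_(i < m.+1) rnorm (e i x) ^+ 2) =
        (fun x => \sum_(i < m) rnorm (e i x) ^+ 2 + rnorm (e m x) ^+ 2).
      by apply/funext => x; rewrite big_ord_recr.
    split; first exact: rintegrableD.
    by rewrite big_ord_recr /= e1 RintegralD.
  by move=> /(_ k (leqnn k))[].
rewrite -[leRHS](Rintegral_constant mu).
apply: le_Rintegral => //; last by apply: continuous_rintegrable; exact: cst_continuous.
apply: continuous_rintegrable.
rewrite (_ : (fun x => _) = \sum_(i < k) (fun x => rnorm (e i x) ^+ 2)); last first.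
  by apply/funext => x; rewrite fct_sumE.
apply: (big_ind (fun f : U -> R => continuous f)).
- exact: cst_continuous.
- by move=> f g cf cg x; exact: cvgD (cf x) (cg x).
- by move=> i _; apply: continuous_sqr_rnorm; apply: SC; exact: eS.
Qed.

Definition spanning k (e : nat -> U -> Cx R) :=
  forall f, S f -> f = combination k e (fun i => inner f (e i)).

(** One Gram-Schmidt step on an f not recovered from its coefficients; the remainder g has positive
    norm because a continuous function of norm zero vanishes. *)
Lemma orthonormal_extend k e : orthonormal_in k e -> ~ spanning k e ->
  exists e', orthonormal_in k.+1 e'.
Proof.
move=> eo; have eS := eo.1; move=> /existsNP[f /not_implyP[Sf nf]].
pose g := f - combination k e (fun i => inner f (e i)).
have Sg : S g by apply: (subspaceB subS) => //; exact: combination_in.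
have Lg := subset_L2 mu SC Sg.
have g0 : 0 < sqn g.
  rewrite lt0r sqnorm_ge0 andbT; apply: contra_notN nf => /eqP /(sqnorm_eq0 haar (SC Sg)).
  by move/eqP; rewrite subr_eq0 => /eqP.
have ge j : (j < k)%N -> inner g (e j) = 0.
  move=> jk; have Lj := subset_L2 mu SC (eS j jk).
  rewrite L2innerB //; [|exact: (subset_L2 mu SC)|by apply: (subset_L2 mu SC); exact: combination_in].
  by rewrite inner_combination_basis // subrr.
pose a : Cx R := ((Num.sqrt (sqn g))^-1%:C)%C.
pose h := a *: g.
have hh : inner h h = 1.
  rewrite L2inner_sqnorm sqnormZ // rnormr ger0_norm ?invr_ge0 ?sqrtr_ge0 //.
  by rewrite exprVn sqr_sqrtr ?mulVf ?gt_eqF // ltW.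
have he j : (j < k)%N -> inner h (e j) = 0.
  by move=> jk; rewrite L2innerZ ?ge ?mulr0 //; apply: (subset_L2 mu SC); exact: eS.
have Sh : S h by exact: (subspaceZ subS).
exists (fun i => if i == k then h else e i); split => [i|i j].
  by rewrite ltnS; case: eqVneq => // ik ilk; apply: eS; rewrite ltn_neqAle ik.
rewrite !ltnS; case: (eqVneq i k) => [->|ik] ik'; case: (eqVneq j k) => [->|jk] jk'.
- by rewrite hh ?eqxx.
- by rewrite he ?ltn_neqAle ?jk // eq_sym (negbTE jk).
- rewrite -L2inner_conj; [|exact: (subset_L2 mu SC)|by apply: (subset_L2 mu SC); apply: eS; rewrite ltn_neqAle ik].
  by rewrite he ?ltn_neqAle ?ik // conjC0 (negbTE ik).
by rewrite eo.2 // ltn_neqAle ?ik ?jk.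
Qed.

(** A family that does not span can be enlarged, while [orthonormal_size] excludes the size
    [Num.bound |C|], which exceeds |C|. *)
Lemma orthonormal_basis_ex : L2closed mu S -> exists k e, orthonormal_in k e /\ spanning k e.
Proof.
move=> /(sup_le_L2 haar subS SC)[C hC].
have : forall m, (exists k e, orthonormal_in k e /\ spanning k e) \/
    exists e, orthonormal_in m e.
  elim=> [|m [|[e eo]]]; first by right; exists (fun=> 0).
  - by left.
  - have [es|/(orthonormal_extend eo)] := pselect (spanning m e); last by right.
    by left; exists m, e.
move=> /(_ (Num.bound `|C|)) [//|[e /(orthonormal_size hC)]].
by rewrite leNgt archi_boundP.
Qed.

End Basis.

(** * The Hahn-Banach theorem *)

Section HahnBanach.
Variables (R : realType) (V : lmodType (Cx R)).
Implicit Types (p q l : V -> R) (u v w : V).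

Definition rscale (t : R) v : V := ((t%:C)%C : Cx R) *: v.

(** One inequality for scaling is enough: applied to t^-1 it yields the other one, so an infimum has
    to be estimated from above only. *)
Definition sublinear p :=
  (forall u v, p (u + v) <= p u + p v) /\
  (forall t v, 0 <= t -> p (rscale t v) <= t * p v).

Definition real_linear l :=
  (forall u v, l (u + v) = l u + l v) /\ (forall t v, l (rscale t v) = t * l v).

Lemma rscale0 v : rscale 0 v = 0.
Proof. exact: scale0r. Qed.

Lemma rscale1 v : rscale 1 v = v.
Proof. exact: scale1r. Qed.

Lemma rscaleA s t v : rscale s (rscale t v) = rscale (s * t) v.
Proof. by rewrite /rscale scalerA -rmorphM. Qed.

Lemma rscaleDr t u v : rscale t (u + v) = rscale t u + rscale t v.
Proof. exact: scalerDr. Qed.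

Lemma rscaleDl s t v : rscale (s + t) v = rscale s v + rscale t v.
Proof. by rewrite /rscale rmorphD scalerDl. Qed.

Lemma sublinear0 p : sublinear p -> p 0 = 0.
Proof.
move=> [pD pZ]; have := pZ 0 0 (lexx 0); have := pD 0 0.
by rewrite rscale0 addr0 mul0r; lra.
Qed.

Lemma sublinearZ p t v : sublinear p -> 0 <= t -> p (rscale t v) = t * p v.
Proof.
move=> sp; rewrite le_eqVlt => /predU1P[<-|t0]; first by rewrite rscale0 mul0r sublinear0.
have h := sp.2 t v (ltW t0); apply: le_anti; rewrite h /=.
have ti0 : 0 <= t^-1 by rewrite invr_ge0 ltW.
have := sp.2 t^-1 (rscale t v) ti0.
by rewrite rscaleA mulVf ?gt_eqF // rscale1 ler_pdivlMl.
Qed.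

Lemma sublinear_geN p v : sublinear p -> - p (- v) <= p v.
Proof.
by move=> sp; have := sp.1 v (- v); rewrite subrr sublinear0 //; lra.
Qed.

Lemma minimal_sublinear p : sublinear p ->
  exists q, [/\ sublinear q, (forall v, q v <= p v) &
    forall r, sublinear r -> (forall v, r v <= q v) -> forall v, r v = q v].
Proof.
move=> sp; pose T := {q : V -> R | sublinear q /\ forall v, q v <= p v}.
(* The order is reversed because [Zorn] yields a maximal element, here a minimal functional. *)
pose le (a b : T) := `[< forall v, sval b v <= sval a v >].
have sT (a : T) : sublinear (sval a) by case: a => ? [].
have pT (a : T) v : sval a v <= p v by case: a => ? [].
have [||a b /asboolP ab /asboolP ba|A totA|q qmin] := @Zorn T le.
- by move=> a; apply/asboolP.
- by move=> a b c /asboolP ab /asboolP bc; apply/asboolP => v; exact: le_trans (bc v) (ab v).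
- apply: eq_sig_hprop => [? ? ?|]; first exact: Prop_irrelevance.
  by apply/funext => v; apply/eqP; rewrite eq_le ab ba.
- have [[a0 Aa0]|nA] := pselect (A !=set0); last first.
    have pp : sublinear p /\ forall v, p v <= p v by split.
    by exists (exist _ p pp) => s As; exfalso; apply: nA; exists s.
  pose E v := [set sval a v | a in A].
  have E0 v : E v !=set0 by exists (sval a0 v), a0.
  (* Every member of the chain satisfies - p (- v) <= - a (- v) <= a v, so the pointwise infimum is
     finite. *)
  have Elb v : has_lbound (E v).
    exists (- p (- v)) => _ [a _ <-]; apply: le_trans (sublinear_geN v (sT a)).
    by rewrite lerN2.
  have qle v a : A a -> inf (E v) <= sval a v by move=> Aa; apply: ge_inf => //; exists a.
  have sq : sublinear (fun v => inf (E v)).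
    split=> [u v|t v].
      rewrite -lerBlDr; apply: lb_le_inf => // _ [a Aa <-].
      rewrite lerBlDr -lerBlDl; apply: lb_le_inf => // _ [b Ab <-].
      (* In a chain the smaller of a and b can be used at both u and v. *)
      rewrite lerBlDl; have [/asboolP ab|/asboolP ba] := totA a b Aa Ab.
        by apply: le_trans (qle _ b Ab) _; apply: le_trans ((sT b).1 u v) _; rewrite lerD2r.
      by apply: le_trans (qle _ a Aa) _; apply: le_trans ((sT a).1 u v) _; rewrite lerD2l.
    rewrite le_eqVlt => /predU1P[<-|t0].
      by rewrite mul0r rscale0; apply: le_trans (qle _ _ Aa0) _; rewrite sublinear0.
    rewrite -ler_pdivrMl //; apply: lb_le_inf => // _ [a Aa <-].
    by rewrite ler_pdivrMl // (le_trans (qle _ a Aa)) // (sT a).2 // ltW.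
  have qp v : inf (E v) <= p v by exact: le_trans (qle v a0 Aa0) (pT a0 v).
  pose P q := sublinear q /\ forall v, q v <= p v.
  exists (exist P (fun v => inf (E v)) (conj sq qp)) => s As; apply/asboolP => v /=; exact: qle.
exists (sval q); split; [exact: sT|exact: pT|move=> r sr rq v].
have rp v' : r v' <= p v' by exact: le_trans (rq v') (pT q v').
have /qmin/(congr1 sval) /= <- // : le q (exist (fun q => sublinear q /\ forall v, q v <= p v) r (conj sr rp)).
by apply/asboolP.
Qed.

(* A minimal sublinear [q] is additive: for fixed [u], the functional
   [w |-> inf_(t >= 0) q (w + t u) - t q u] is sublinear and below [q], hence it is [q],
   and [t = 1] gives [q w + q u <= q (w + u)]. *)
Lemma sublinear_dominates p : sublinear p ->
  exists2 l, real_linear l & forall v, l v <= p v.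
Proof.
move=> /minimal_sublinear[q [sq qp qmin]]; exists q => //.
have qD u v : q u + q v = q (u + v).
  pose E w := [set q (w + rscale t u) - t * q u | t in [set t | 0 <= t]].
  have E0 w : E w !=set0 by exists (q (w + rscale 0 u) - 0 * q u), 0 => /=.
  have Elb w : has_lbound (E w).
    exists (- q (- w)) => _ [t /= t0 <-].
    have := sq.1 (w + rscale t u) (- w); rewrite addrAC subrr add0r sublinearZ //; lra.
  have Ele w t : 0 <= t -> inf (E w) <= q (w + rscale t u) - t * q u.
    by move=> t0; apply: ge_inf => //; exists t.
  have sE : sublinear (fun w => inf (E w)).
    split=> [w w'|t w].
      rewrite -lerBlDr; apply: lb_le_inf => // _ [t /= t0 <-].
      rewrite lerBlDr -lerBlDl; apply: lb_le_inf => // _ [s /= s0 <-].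
      rewrite lerBlDl; apply: le_trans (Ele _ (t + s) (addr_ge0 t0 s0)) _.
      have := sq.1 (w + rscale t u) (w' + rscale s u).
      rewrite addrACA -rscaleDl; lra.
    rewrite le_eqVlt => /predU1P[<-|t0].
      rewrite mul0r rscale0; apply: le_trans (Ele _ 0 (lexx 0)) _.
      by rewrite rscale0 addr0 sublinear0 // mul0r subr0.
    rewrite -ler_pdivrMl //; apply: lb_le_inf => // _ [s /= s0 <-].
    rewrite ler_pdivrMl //; apply: le_trans (Ele _ (t * s) (mulr_ge0 (ltW t0) s0)) _.
    by rewrite -rscaleA -rscaleDr (sublinearZ _ sq (ltW t0)) mulrBr mulrA.
  have Eq w : inf (E w) <= q w.
    by apply: le_trans (Ele w 0 (lexx 0)) _; rewrite rscale0 addr0 mul0r subr0.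
  have := Ele v 1 ler01; rewrite (qmin _ sE Eq v) rscale1 mul1r => h.
  apply/eqP; rewrite eq_le [q (u + v) <= _]sq.1 andbT [u + v]addrC; lra.
split => [u v|t v]; first by rewrite qD.
have [t0|t0] := leP 0 t; first exact: sublinearZ.
have qN w : q (- w) = - q w by have := qD w (- w); rewrite subrr sublinear0 //; lra.
have : q (rscale (- t) v) = - t * q v by rewrite sublinearZ // oppr_ge0 ltW.
have -> : rscale (- t) v = - rscale t v by rewrite /rscale rmorphN scaleNr.
by rewrite qN; lra.
Qed.

End HahnBanach.

(** * The Banach space of bounded functions *)

Section BoundedFunctions.
Variables (R : realType) (T : pointedType).

Definition bounded_functions : {pred T -> Cx R} :=
  fun f => `[< exists M, forall x, rnorm (f x) <= M >].

Lemma bounded_functionsP f :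
  reflect (exists M, forall x, rnorm (f x) <= M) (f \in bounded_functions).
Proof. exact: asboolP. Qed.

Lemma bounded_functions_submod_closed : submod_closed bounded_functions.
Proof.
split=> [|a f g /bounded_functionsP[M fM] /bounded_functionsP[N gN]]; apply/bounded_functionsP.
  by exists 0 => x; rewrite rnorm0.
exists (rnorm a * M + N) => x; apply: le_trans (rnormD _ _) _.
by rewrite lerD // -[(_ *: f) x]/(a * f x) rnormM ler_wpM2l ?rnorm_ge0.
Qed.

HB.instance Definition _ :=
  GRing.isSubmodClosed.Build (Cx R) (T -> Cx R) bounded_functions bounded_functions_submod_closed.

(** This space serves twice: as the Banach space that receives S in the lower bound, and as the
    domain of the upper integral. *)
Record linf := Linf { linf_val :> T -> Cx R; _ : linf_val \in bounded_functions }.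

HB.instance Definition _ := [isSub of linf for linf_val].
HB.instance Definition _ := [Choice of linf by <:].
HB.instance Definition _ := [SubChoice_isSubLmodule of linf by <:].

Definition supremum (f : T -> Cx R) : R := sup (range (fun x => rnorm (f x))).

Lemma range_has_sup f : f \in bounded_functions -> has_sup (range (fun x => rnorm (f x))).
Proof.
move=> /bounded_functionsP[M fM]; split; first by exists (rnorm (f point)), point.
by exists M => _ [x _ <-].
Qed.

Lemma le_supremum f x : f \in bounded_functions -> rnorm (f x) <= supremum f.
Proof. by move=> /range_has_sup bf; apply: sup_upper_bound => //; exists x. Qed.

Lemma supremum_le f M : (forall x, rnorm (f x) <= M) -> supremum f <= M.
Proof.
move=> fM; apply: ge_sup; first by exists (rnorm (f point)), point.
by move=> _ [x _ <-].
Qed.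

Lemma linf_boundedP (f : linf) : (f : T -> Cx R) \in bounded_functions.
Proof. by case: f. Qed.

Definition linf_norm (f : linf) : Cx R := ((supremum f)%:C)%C.

Lemma linf_normD (f g : linf) : linf_norm (f + g) <= linf_norm f + linf_norm g.
Proof.
rewrite /linf_norm -rmorphD lecR; apply: supremum_le => x.
apply: le_trans (rnormD _ _) _.
by rewrite lerD // le_supremum // linf_boundedP.
Qed.

Lemma supremum_ge0 (f : linf) : 0 <= supremum f.
Proof. exact: le_trans (rnorm_ge0 (f point)) (le_supremum _ (linf_boundedP f)). Qed.

Lemma linf_normZ (a : Cx R) (f : linf) : linf_norm (a *: f) = `|a| * linf_norm f.
Proof.
rewrite /linf_norm normE -rmorphM /=; congr (_%:C)%C; apply/eqP; rewrite eq_le; apply/andP; split.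
  apply: supremum_le => x; change (rnorm (a * f x) <= rnorm a * supremum f).
  by rewrite rnormM ler_wpM2l ?rnorm_ge0 // le_supremum // linf_boundedP.
have [->|a0] := eqVneq a 0; first by rewrite rnorm0 mul0r; exact: (supremum_ge0 (0 *: f)).
have an : 0 < rnorm a by rewrite lt0r rnorm_ge0 andbT; apply: contra_neq a0 => /rnorm_eq0.
rewrite -ler_pdivlMl //; apply: supremum_le => x; rewrite ler_pdivlMl // -rnormM.
exact: (le_supremum x (linf_boundedP (a *: f))).
Qed.

Lemma linf_norm_eq0 (f : linf) : linf_norm f = 0 -> f = 0.
Proof.
move=> /complexI f0; apply: val_inj; apply/funext => x; apply: rnorm_eq0.
by apply/eqP; rewrite eq_le rnorm_ge0 andbT -f0 le_supremum // linf_boundedP.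
Qed.

HB.instance Definition _ :=
  Lmodule_isNormed.Build (Cx R) linf linf_normD linf_normZ linf_norm_eq0.

Lemma linf_le_rnorm (f : linf) x : rnorm (f x) <= rnorm f.
Proof. exact: (le_supremum x (linf_boundedP f)). Qed.

Lemma linf_complete (F : set_system linf) : ProperFilter F -> cauchy F -> cvg F.
Proof.
move=> FF /cauchy_ballP Fc.
have near2 (e : R) : 0 < e -> exists2 A, F A & forall f g, A f -> A g -> rnorm (f - g) < e.
  move=> e0; have /Fc [[A B] /= [FA FB] AB] : 0 < ((e%:C)%C : Cx R) by rewrite ltcR.
  exists (A `&` B); first exact: filterI.
  move=> f g [Af _] [_ Bg]; have := AB (f, g) (conj Af Bg).
  by rewrite /= -ball_normE /= normE ltcR.
have cvgp (p : Cx R -> R) : (forall z w, `|p z - p w| <= rnorm (z - w)) -> forall x,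
    (fun f : linf => p (f x)) @ F --> lim ((fun f : linf => p (f x)) @ F).
  move=> pl x; apply: cauchy_cvg; apply/cauchy_ballP => e e0.
  have [A FA Ae] := near2 e e0; pose B := (fun f : linf => p (f x)) @` A.
  have FB : F ((fun f : linf => p (f x)) @^-1` B) by apply: filterS FA => f Af; exists f.
  exists (B, B) => // -[_ _] /= [[f Af <-] [g Ag <-]].
  rewrite -ball_normE /=; apply: le_lt_trans (pl _ _) _.
  exact: le_lt_trans (linf_le_rnorm (f - g) x) (Ae f g Af Ag).
have lRe (z w : Cx R) : `|Re z - Re w| <= rnorm (z - w) by rewrite -cReN -cReD norm_Re_le.
have lIm (z w : Cx R) : `|Im z - Im w| <= rnorm (z - w) by rewrite -cImN -cImD norm_Im_le.
pose g x : Cx R := Complex (lim ((fun f : linf => Re (f x)) @ F)) (lim ((fun f : linf => Im (f x)) @ F)).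
have Fg x : (fun f : linf => f x) @ F --> g x.
  by apply: cvg_complex; [exact: cvgp _ lRe x|exact: cvgp _ lIm x].
have near1 (e : R) : 0 < e -> F [set f : linf | forall x, rnorm (f x - g x) <= e].
  move=> e0; have e20 : 0 < e / 2 by rewrite divr_gt0.
  (* The auxiliary h below may depend on x: it is close to g at x only, but within e / 2 of f in
     norm, so the estimate is uniform in x. *)
  have [A FA Ae] := near2 _ e20; apply: (filterS _ (FA)) => f Af x.
  have /cvgCP/(_ _ e20) hx := Fg x.
  have [h [Ah hgx]] : exists h, A h /\ rnorm (h x - g x) < e / 2 by exact: filter_ex (filterI FA hx).
  rewrite (splitr e).
  have -> : f x - g x = (f x - h x) + (h x - g x) by rewrite addrA subrK.
  apply: le_trans (rnormD _ _) (lerD _ (ltW hgx)).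
  exact: le_trans (linf_le_rnorm (f - h) x) (ltW (Ae f h Af Ah)).
have gb : g \in bounded_functions.
  have /filter_ex[f fg] := near1 1 ltr01.
  apply/bounded_functionsP; exists (1 + rnorm f) => x.
  have -> : g x = - (f x - g x) + f x by rewrite opprB subrK.
  by apply: le_trans (rnormD _ _) _; rewrite rnormN lerD // linf_le_rnorm.
apply/cvg_ex; exists (Linf gb); apply/cvgrPdist_le => -[e e'] /=.
rewrite ltcE /= => /andP[/eqP -> e0].
apply: filterS (near1 e e0) => f fg.
rewrite normE -[Complex e 0]/((e%:C)%C) lecR.
apply: supremum_le => x; change (rnorm (g x - f x) <= e).
by rewrite -rnormN opprB.
Qed.

HB.instance Definition _ := Uniform_isComplete.Build linf linf_complete.

End BoundedFunctions.

(** * The reproducing kernel *)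

Section Kernel.
Variables (R : realType) (n : nat) (mu : probability (unitary_group R n) R).
Local Notation U := (unitary_group R n).
Local Notation L2 := (L2space mu).
Local Notation sqn := (sqnorm mu).
Local Notation inner := (L2inner mu).
Variable S : set (U -> Cx R).
Hypothesis haar : is_haar mu.
Hypothesis subS : is_subspace S.
Hypothesis SC : S `<=` @Cspace R n.
Hypothesis invS : unitary_invariant S.
Variables (k : nat) (e : nat -> U -> Cx R).
Hypothesis eo : orthonormal_in mu S k e.
Hypothesis es : spanning mu S k e.

Lemma basis_in i : (i < k)%N -> S (e i). Proof. exact: eo.1. Qed.

Definition rkernel (x : U) : U -> Cx R := combination k e (fun i => (e i x)^* ).

Lemma rkernel_in x : S (rkernel x).
Proof. apply: (combination_in subS); exact: basis_in. Qed.

Lemma inner_kernel f x : L2 f ->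
  inner f (rkernel x) = combination k e (fun i => inner f (e i)) x.
Proof.
move=> hf; have Lk := subset_L2 mu SC (rkernel_in x).
rewrite -L2inner_conj // (inner_combination SC) //; last exact: basis_in.
rewrite combinationE rmorph_sum; apply: eq_bigr => i _.
by rewrite rmorphM /= conjCK L2inner_conj // 1?mulrC //; apply: (subset_L2 mu SC); exact: basis_in.
Qed.

Lemma reproducing f x : S f -> f x = inner f (rkernel x).
Proof.
move=> Sf; rewrite inner_kernel; last exact: (subset_L2 mu SC).
exact: (congr1 (fun g => g x) (es Sf)).
Qed.

Lemma inner_eq0 f : S f -> (forall h, S h -> inner f h = 0) -> f = 0.
Proof.
move=> Sf fh; apply: (sqnorm_eq0 haar (SC Sf)); apply: complexI.
by rewrite -L2inner_sqnorm fh.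
Qed.

(** The choice made by [xget] is harmless: two candidates differ by an element of S orthogonal to S,
    hence by 0. *)
Lemma L2projE f : L2 f -> L2proj mu S f = combination k e (fun i => inner f (e i)).
Proof.
move=> hf; set g := combination _ _ _.
have Sg : S g by apply: (combination_in subS); exact: basis_in.
have Lg := subset_L2 mu SC Sg.
have gP : S g /\ forall h, S h -> inner (f - g) h = 0.
  split=> // h Sh; have Lh := subset_L2 mu SC Sh.
  have Lfg := L2_sub hf Lg.
  rewrite -L2inner_conj // [h in inner h _](es Sh) (inner_combination SC) //; last exact: basis_in.
  rewrite big1 ?conjC0 // => i _; have Li := subset_L2 mu SC (basis_in (ltn_ord i)).
  rewrite -(L2inner_conj Lfg Li) L2innerB //.
  by rewrite (inner_combination_basis SC) // subrr conjC0 mulr0.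
rewrite /L2proj; case: xgetP => [g' _|/(_ g) //] [Sg' g'P].
apply/eqP; rewrite -subr_eq0; apply/eqP; apply: inner_eq0; first exact: (subspaceB subS).
move=> h Sh; have Lh := subset_L2 mu SC Sh.
have -> : g' - g = (f - g) - (f - g') by rewrite opprB [RHS]addrC addrA subrK.
rewrite L2innerB ?gP.2 ?g'P ?subrr //; first exact: L2_sub.
by apply: L2_sub => //; exact: (subset_L2 mu SC).
Qed.

Lemma L2proj_kernel f x : L2 f -> L2proj mu S f x = inner f (rkernel x).
Proof. by move=> hf; rewrite L2projE // inner_kernel. Qed.

Lemma repr_kernelE : repr_kernel mu S = rkernel (unitary1 R n).
Proof.
rewrite /repr_kernel; case: xgetP => [t _|/(_ (rkernel (unitary1 R n)))]; last first.
  by case; split; [exact: rkernel_in|move=> f hf; exact: L2proj_kernel].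
move=> [St tP]; apply/eqP; rewrite -subr_eq0; apply/eqP.
apply: inner_eq0; first by apply: (subspaceB subS) => //; exact: rkernel_in.
move=> h Sh; have Lh := subset_L2 mu SC Sh; have Lk := subset_L2 mu SC (rkernel_in (unitary1 R n)).
have Lt := subset_L2 mu SC St.
rewrite -L2inner_conj //; last exact: L2_sub.
rewrite -L2inner_conj //; last exact: L2_sub.
by rewrite L2innerB // -(L2inner_conj Lh Lt) -tP // L2proj_kernel // L2inner_conj // subrr !conjC0.
Qed.

(** Evaluate f at x as f(x .) at Id: f x = <f(x .), t> = <f, t(x^-1 .)> by invariance of mu; both
    sides thus represent the same functional on S. *)
Lemma rkernel_transl x : rkernel x = rkernel (unitary1 R n) \o translL (unitaryV x).
Proof.
set t := rkernel (unitary1 R n); set a := translL (unitaryV x).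
have Sta : S (t \o a) by exact: (invS (unitaryV x) (rkernel_in _)).1.
have rep f : S f -> f x = inner f (t \o a).
  move=> Sf; have Sfx : S (f \o translL x) by exact: (invS x Sf).1.
  have -> : f x = (f \o translL x) (unitary1 R n) by rewrite /= /translL unitaryM1.
  rewrite reproducing // -/t.
  have c : continuous (fun V => (f \o translL x) V * (t V)^* ).
    by apply: continuous_mul; [exact: SC|apply: continuous_conj; apply: SC; exact: rkernel_in].
  rewrite /L2inner -(cintegral_preserving (preserving_translL haar (unitaryV x)) (continuous_cintegrable mu c)).
  congr (cintegral mu _); apply/funext => V /=.
  by rewrite /translL unitaryA unitaryMV unitary1M.
apply/eqP; rewrite -subr_eq0; apply/eqP.
apply: inner_eq0; first by apply: (subspaceB subS) => //; exact: rkernel_in.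
move=> h Sh; have Lh := subset_L2 mu SC Sh; have Lk := subset_L2 mu SC (rkernel_in x).
have Lt := subset_L2 mu SC Sta.
rewrite L2innerB // -(L2inner_conj Lh Lk) -(L2inner_conj Lh Lt).
by rewrite -reproducing // -rep // subrr.
Qed.

Lemma Rintegral_kernel x :
  \int[mu]_y rnorm (rkernel x y) = \int[mu]_y rnorm (rkernel (unitary1 R n) y).
Proof.
have c : continuous (fun y => rnorm (rkernel (unitary1 R n) y)).
  by apply: continuous_rnorm; apply: SC; exact: rkernel_in.
rewrite rkernel_transl.
exact: (Rintegral_preserving (preserving_translL haar _) (continuous_unitary_measurable c)).
Qed.

End Kernel.

(** * The upper bound *)

Section Complexification.
Variables (R : realType) (V : lmodType (Cx R)) (l : V -> R).
Hypothesis ll : real_linear l.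

(** The unique complex-linear functional with real part l, namely l v - i l (i v). *)
Definition complexify (v : V) : Cx R :=
  Complex (l v) (- l ((Complex 0 1 : Cx R) *: v)).

Lemma real_linearN v : l (- v) = - l v.
Proof.
have -> : - v = rscale (-1) v by rewrite /rscale rmorphN1 scaleN1r.
by rewrite ll.2 mulN1r.
Qed.

Lemma complexify_linear a u v : complexify (a *: u + v) = a * complexify u + complexify v.
Proof.
pose i : Cx R := Complex 0 1.
have lZ w : l (a *: w) = Re a * l w + Im a * l (i *: w).
  have -> : a *: w = rscale (Re a) w + rscale (Im a) (i *: w).
    rewrite /rscale scalerA -scalerDl; congr (_ *: w).
    by apply: complex_ext; rewrite ?cReD ?cImD ?cReM ?cImM /=; ring.
  by rewrite ll.1 !ll.2.
rewrite /complexify -/i scalerDr !ll.1 scalerA [i * a]mulrC -scalerA !lZ.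
have -> : i *: (i *: u) = - u.
  rewrite scalerA (_ : i * i = -1) ?scaleN1r //.
  by apply: complex_ext; rewrite ?cReM ?cImM ?cReN ?cImN /=; ring.
rewrite real_linearN.
by apply: complex_ext; rewrite ?cReD ?cImD ?cReM ?cImM /=; ring.
Qed.

(** A unimodular c makes the value at c v equal to the modulus of the value at v, so it is real and
    equals l (c v). *)
Lemma complexify_le v M :
  (forall c : Cx R, rnorm c = 1 -> l (c *: v) <= M) -> rnorm (complexify v) <= M.
Proof.
move=> h; have [c c1 cv] := rotation (complexify v).
have := complexify_linear c v 0; rewrite addr0.
have -> : complexify 0 = 0.
  have l0 : l 0 = 0 by have := real_linearN 0; rewrite oppr0; lra.
  by rewrite /complexify scaler0 l0 oppr0.
by rewrite addr0 cv => /(congr1 Re) /= <-; exact: h.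
Qed.

End Complexification.

(** * Extension of the evaluation functionals with norm at most 1 *)

Section EmbeddingFunctionals.
Variables (R : realType) (n : nat).
Local Notation U := (unitary_group R n).
Variables (S : set (U -> Cx R)) (Y : normedModType (Cx R)) (I : (U -> Cx R) -> Y).
Hypothesis subS : is_subspace S.
Hypothesis SC : S `<=` @Cspace R n.
Hypothesis iI : isometric_embedding (@supnorm R n) S I.

Lemma isometric_le f x : S f -> rnorm (f x) <= rnorm (I f).
Proof.
move=> Sf; rewrite -lee_fin -[leRHS]/(enorm (I f)) iI.2 //.
by apply: ereal_sup_ubound; exists x.
Qed.

Lemma isometric0 : I 0 = 0.
Proof.
have := iI.1 1 0 0 subS.1 subS.1; rewrite scaler0 addr0 scale1r.
by move=> /eqP; rewrite -subr_eq subrr => /eqP.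
Qed.

Lemma isometricD f g : S f -> S g -> I (f + g) = I f + I g.
Proof. by move=> Sf Sg; have := iI.1 1 f g Sf Sg; rewrite !scale1r. Qed.

Lemma isometricZ a f : S f -> I (a *: f) = a *: I f.
Proof. by move=> Sf; have := iI.1 a f 0 Sf subS.1; rewrite isometric0 !addr0. Qed.

Lemma extend_evaluation (x : U) : exists h : Y -> Cx R,
  [/\ forall a u v, h (a *: u + v) = a * h u + h v,
      forall y, rnorm (h y) <= rnorm y &
      forall f, S f -> h (I f) = f x].
Proof.
(* A linear l below the infimum has l y <= |y| (take f = 0) and l (I f) <= Re (f x); the latter for
   - f gives equality. The infimum is finite since Re (f x) >= - |I f|. *)
pose E (y : Y) := [set rnorm (y - I f) + Re (f x) | f in S].
have E0 y : E y !=set0 by exists (rnorm (y - I 0) + Re ((0 : U -> Cx R) x)), 0 => //; exact: subS.1.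
have Elb y : has_lbound (E y).
  exists (- rnorm y) => _ [f Sf <-].
  have := rnorm_dist (I f) y; rewrite -(rnormN (I f - y)) opprB.
  have := ler_norm (rnorm (I f) - rnorm y).
  have := isometric_le x Sf; have := norm_Re_le (f x); rewrite ler_norml => /andP[].
  lra.
pose p y := inf (E y).
have ple y f : S f -> p y <= rnorm (y - I f) + Re (f x).
  by move=> Sf; apply: ge_inf => //; exists f.
have sp : sublinear p.
  split=> [u v|t v].
    rewrite -lerBlDr; apply: lb_le_inf => // _ [f Sf <-].
    rewrite lerBlDr -lerBlDl; apply: lb_le_inf => // _ [g Sg <-].
    rewrite lerBlDl; apply: le_trans (ple _ _ (subspaceD subS Sf Sg)) _.
    rewrite isometricD // -[(f + g) x]/(f x + g x) cReD.
    have := rnormD (u - I f) (v - I g); rewrite addrACA -opprD; lra.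
  rewrite le_eqVlt => /predU1P[<-|t0].
    rewrite mul0r rscale0; apply: le_trans (ple _ _ subS.1) _.
    by rewrite isometric0 subrr rnorm0 add0r.
  rewrite -ler_pdivrMl //; apply: lb_le_inf => // _ [f Sf <-].
  rewrite ler_pdivrMl //; apply: le_trans (ple _ _ (subspaceZ subS ((t%:C)%C) Sf)) _.
  rewrite isometricZ // -scalerBr rnormZ rnormr (ger0_norm (ltW t0)).
  by rewrite -[(_ *: f) x]/(((t%:C)%C : Cx R) * f x) cReM /= mul0r subr0 mulrDr.
have [l ll lp] := sublinear_dominates sp.
have lI f : S f -> l (I f) = Re (f x).
  move=> Sf; apply/eqP; rewrite eq_le; apply/andP; split.
    by apply: le_trans (lp _) _; have := ple (I f) f Sf; rewrite subrr rnorm0 add0r.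
  have SNf : S (- f) by rewrite -scaleN1r; exact: (subspaceZ subS).
  have IN : I (- f) = - I f by rewrite -scaleN1r isometricZ // scaleN1r.
  have := ple (- I f) _ SNf; rewrite IN subrr rnorm0 add0r -[(- f) x]/(- f x) cReN.
  have := lp (- I f); rewrite real_linearN //; lra.
exists (complexify l); split.
- exact: complexify_linear.
- move=> y; apply: complexify_le => // c c1; apply: le_trans (lp _) _.
  apply: le_trans (ple _ _ subS.1) _.
  by rewrite isometric0 subr0 addr0 rnormZ c1 mul1r.
move=> f Sf; rewrite /complexify -isometricZ // !lI //; last exact: (subspaceZ subS).
apply: complex_ext => //=.
by rewrite -[(_ *: f) x]/((Complex 0 1 : Cx R) * f x) cReM /=; ring.
Qed.

End EmbeddingFunctionals.

(** * Extension of the integral to all bounded functions *)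

Section IntegralExtension.
Variables (R : realType) (n : nat) (mu : probability (unitary_group R n) R).
Local Notation U := (unitary_group R n).
Local Notation bounded := (@bounded_functions R U).

(* Hahn-Banach for the upper integral [g |-> inf {int phi | phi continuous, Re g <= phi}],
   which is the integral of [Re g] when [g] is continuous. *)
Lemma integral_extension : exists L : (U -> Cx R) -> Cx R,
  [/\ forall a f g, f \in bounded -> g \in bounded -> L (a *: f + g) = a * L f + L g,
      forall f, continuous f -> L f = cintegral mu f &
      forall f (phi : U -> R), continuous phi -> (forall x, rnorm (f x) <= phi x) ->
        rnorm (L f) <= \int[mu]_x phi x].
Proof.
pose E (g : linf R U) := [set \int[mu]_x phi x | phi in
  [set phi : U -> R | continuous phi /\ forall x, Re (g x) <= phi x]].
have cc (r : R) : continuous (fun _ : U => r) by exact: cst_continuous.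
have E0 g : E g !=set0.
  exists (\int[mu]_x rnorm g), (fun=> rnorm g) => //; split; first exact: cc.
  by move=> x; apply: le_trans (Re_le _) (linf_le_rnorm g x).
have Elb g : has_lbound (E g).
  exists (- rnorm g) => _ [phi [cphi gphi] <-].
  rewrite -(Rintegral_constant mu (- rnorm g)); apply: Rintegral_le => [||x].
  - by apply: continuous_rintegrable; exact: cc.
  - exact: continuous_rintegrable.
  apply: le_trans (gphi x); have := norm_Re_le (g x); rewrite ler_norml => /andP[+ _].
  by apply: le_trans; rewrite lerN2; exact: linf_le_rnorm.
pose p g := inf (E g).
have ple (g : linf R U) (phi : U -> R) : continuous phi -> (forall x, Re (g x) <= phi x) -> p g <= \int[mu]_x phi x.
  by move=> c gphi; apply: ge_inf => //; exists phi.
have sp : sublinear p.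
  split=> [u v|t v].
    rewrite -lerBlDr; apply: lb_le_inf => // _ [f [cf uf] <-].
    rewrite lerBlDr -lerBlDl; apply: lb_le_inf => // _ [g [cg vg] <-].
    rewrite lerBlDl -RintegralD //; try exact: continuous_rintegrable.
    apply: ple => x; first exact: cvgD (cf x) (cg x).
    by rewrite -[linf_val (u + v) x]/(u x + v x) cReD lerD.
  rewrite le_eqVlt => /predU1P[<-|t0].
    rewrite mul0r rscale0; apply: (@le_trans _ _ (\int[mu]_x (cst 0 : U -> R) x)).
      by apply: ple => [|x]; [exact: cc|exact: lexx].
    by rewrite Rintegral_constant.
  rewrite -ler_pdivrMl //; apply: lb_le_inf => // _ [f [cf vf] <-].
  rewrite ler_pdivrMl // -RintegralZl //; last exact: continuous_rintegrable.
  apply: ple => x; first exact: cvgM (cc t x) (cf x).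
  by rewrite -[linf_val _ x]/(((t%:C)%C : Cx R) * v x) cReM /= mul0r subr0 ler_wpM2l // ltW.
have [l ll lp] := sublinear_dominates sp.
have lc (g : linf R U) : continuous (g : U -> Cx R) -> l g = \int[mu]_x Re (g x).
  move=> cg; have cR := continuous_Re cg; have iR := continuous_rintegrable mu cR.
  apply/eqP; rewrite eq_le; apply/andP; split; first by apply: le_trans (lp _) (ple _ _ cR _).
  have : l (- g) <= - \int[mu]_x Re (g x).
    rewrite -mulN1r -RintegralZl //; apply: le_trans (lp _) (ple _ _ _ _).
      by move=> x; exact: cvgM (cc (-1) x) (cR x).
    by move=> x; rewrite -[linf_val (- g) x]/(- g x) cReN mulN1r.
  by rewrite real_linearN //; lra.
(* Unbounded functions are sent to 0; this is why linearity of L is asserted on bounded functions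
   only. *)
pose w (f : U -> Cx R) : linf R U := insubd 0 f.
have wK f : f \in bounded -> (w f : U -> Cx R) = f by move=> bf; exact: insubdK.
have cb f : continuous f -> f \in bounded.
  by move=> cf; apply/bounded_functionsP; exact: continuous_complex_bounded.
exists (fun f => complexify l (w f)); split.
- move=> a f g bf bg; rewrite -complexify_linear //; congr complexify.
  apply: val_inj => /=; rewrite wK ?rpredD ?rpredZ //.
  by rewrite -[linf_val (w f)]/(w f : U -> Cx R) !wK.
- move=> f cf; have bf := cb f cf.
  rewrite /complexify /cintegral; congr Complex; first by rewrite lc wK.
  have E1 : (((Complex 0 1 : Cx R) *: w f : linf R U) : U -> Cx R) = (fun x => Complex 0 1 * f x).
    by apply/funext => x; rewrite -[LHS]/((Complex 0 1 : Cx R) * w f x) wK.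
  have c1 : continuous (fun x => (Complex 0 1 : Cx R) * f x).
    exact: (@continuous_mul _ _ (fun=> Complex 0 1) f (@continuous_cst _ _ _) cf).
  rewrite lc E1 //.
  rewrite -mulN1r -RintegralZl //; last exact: continuous_rintegrable (continuous_Re c1).
  by apply: eq_Rintegral => x _; rewrite cReM /=; ring.
move=> f phi cphi fphi; apply: complexify_le => // c c1; apply: le_trans (lp _) _.
have bf : f \in bounded.
  have [M hM] := continuous_bounded cphi.
  by apply/bounded_functionsP; exists M => x; exact: le_trans (fphi x) (le_trans (ler_norm _) (hM x)).
apply: ple => // x; rewrite -[linf_val _ x]/(c * w f x) wK //.
by apply: le_trans (Re_le _) _; rewrite rnormM c1 mul1r.
Qed.

End IntegralExtension.

(** * Projections onto isometric copies of S *)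

Section UpperBound.
Variables (R : realType) (n : nat) (mu : probability (unitary_group R n) R).
Local Notation U := (unitary_group R n).
Local Notation inner := (L2inner mu).
Local Notation bounded := (@bounded_functions R U).
Variable S : set (U -> Cx R).
Hypothesis haar : is_haar mu.
Hypothesis subS : is_subspace S.
Hypothesis SC : S `<=` @Cspace R n.
Hypothesis invS : unitary_invariant S.
Variables (k : nat) (e : nat -> U -> Cx R).
Hypothesis eo : orthonormal_in mu S k e.
Hypothesis es : spanning mu S k e.
Local Notation rkernel := (rkernel k e).
Local Notation t1 := (\int[mu]_y rnorm (rkernel (unitary1 R n) y)).

Lemma supnorm_le (f : U -> Cx R) M : (forall x, rnorm (f x) <= M) -> (supnorm f <= M%:E)%E.
Proof. by move=> fM; apply: ge_ereal_sup => _ [x _ <-]; rewrite lee_fin. Qed.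

Lemma le_supnorm (f : U -> Cx R) M x : (supnorm f <= M%:E)%E -> rnorm (f x) <= M.
Proof.
by move=> fM; rewrite -lee_fin; apply: le_trans fM; apply: ereal_sup_ubound; exists x.
Qed.

Lemma relative_projection_constant_le (Y : normedModType (Cx R)) (I : (U -> Cx R) -> Y) :
  isometric_embedding (@supnorm R n) S I ->
  (relative_projection_constant (I @` S) <= t1%:E)%E.
Proof.
move=> iI; have [L [Llin Lcont Lle]] := integral_extension mu.
have [h hP] := choice (extend_evaluation subS iI).
have hlin x a u v : h x (a *: u + v) = a * h x u + h x v by case: (hP x).
have hle x y : rnorm (h x y) <= rnorm y by case: (hP x).
have hI x f : S f -> h x (I f) = f x by case: (hP x) => _ _; apply.
have cke i : (i < k)%N -> continuous (e i) by move=> ik; apply: SC; exact: eo.1.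
pose H y i : U -> Cx R := fun x => h x y * (e i x)^*.
have Hb y i : (i < k)%N -> H y i \in bounded.
  move=> /cke /continuous_complex_bounded[M hM]; apply/bounded_functionsP; exists (rnorm y * M) => x.
  by rewrite rnormM rnormJ ler_pM ?rnorm_ge0.
(* The formula for pi_S with f z replaced by h_z y and the integral by L; on y = I f it is pi_S f =
   f. *)
pose q y := combination k e (fun i => L (H y i)).
have Sq y : S (q y) by apply: (combination_in subS); exact: eo.1.
have qlin a u v : q (a *: u + v) = a *: q u + q v.
  apply/funext => x; rewrite -[RHS]/(a * q u x + q v x) /q !combinationE mulr_sumr -big_split /=.
  apply: eq_bigr => i _; rewrite mulrA -mulrDl; congr (_ * _).
  rewrite -Llin; [|exact: Hb|exact: Hb]; congr L; apply/funext => z.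
  by rewrite -[RHS]/(a * H u i z + H v i z) /H hlin mulrDl mulrA.
have qI f : S f -> q (I f) = f.
  move=> Sf; rewrite [RHS](es Sf); apply: eq_bigr => i _; congr (_ *: _).
  rewrite Lcont; last first.
    rewrite (_ : H _ _ = (fun x => f x * (e i x)^*)); last by apply/funext => x; rewrite /H hI.
    exact: continuous_mul (SC Sf) (continuous_conj (cke i (ltn_ord i))).
  by congr (cintegral mu _); apply/funext => x; rewrite /H hI.
(* The sum is moved inside L, where it becomes h_z y times the conjugate kernel. Boundedness is
   carried along because L is linear on bounded functions. *)
have Lsum y x m : (m <= k)%N ->
    \sum_(i < m) L (H y i) * e i x = L (\sum_(i < m) e i x *: H y i) /\
    \sum_(i < m) e i x *: H y i \in bounded.
  elim: m => [_|m IH mk].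
    rewrite !big_ord0; split; last exact: rpred0.
    have b0 : (0 : U -> Cx R) \in bounded by exact: rpred0.
    by have := Llin (-1) 0 0 b0 b0; rewrite scaler0 addr0 mulN1r addNr.
  have [IH1 IH2] := IH (ltnW mk); rewrite !big_ord_recr /=; split.
    by rewrite IH1 [L (H y m) * _]mulrC addrC -Llin //; [congr L; rewrite addrC|exact: Hb].
  by rewrite rpredD // rpredZ // Hb.
have qle y x : rnorm (q y x) <= rnorm y * t1.
  rewrite /q combinationE (Lsum y x k (leqnn k)).1 -(Rintegral_kernel haar subS SC invS eo es x).
  have ck : continuous (fun z => rnorm (rkernel x z)).
    by apply: continuous_rnorm; apply: SC; exact: (rkernel_in subS eo).
  rewrite -RintegralZl //; last exact: continuous_rintegrable.
  apply: Lle => [z|z]; first exact: cvgM (@cst_continuous _ _ (rnorm y) z) (ck z).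
  have -> : (\sum_(i < k) e i x *: H y i) z = h z y * (rkernel x z)^*.
    rewrite fct_sumE /rkernel combinationE rmorph_sum mulr_sumr; apply: eq_bigr => i _.
    rewrite -[LHS]/(e i x * (h z y * (e i z)^*)) rmorphM /= conjCK.
    by rewrite mulrCA.
  by rewrite rnormM rnormJ ler_wpM2r ?rnorm_ge0.
pose P y := I (q y).
have opP : (opnorm (@enorm R Y) setT (@enorm R Y) P <= t1%:E)%E.
  apply: ge_ereal_sup => _ [y [_ y1] <-]; rewrite /P iI.2 //.
  apply: supnorm_le => x; apply: le_trans (qle y x) _.
  rewrite ler_piMl //; first by apply: Rintegral_ge0 => z _; exact: rnorm_ge0.
apply: ge_ereal_inf; exists (opnorm (@enorm R Y) setT (@enorm R Y) P) => //.
exists P => //; split.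
- move=> a u v _ _; rewrite /P qlin iI.1 //.
- exact: le_lt_trans opP (ltry _).
- by move=> y _; exists (q y).
- by move=> _ [f Sf <-]; rewrite /P qI.
Qed.

Lemma projection_constant_le : (projection_constant (@supnorm R n) S <= t1%:E)%E.
Proof.
by apply: ge_ereal_sup => _ [Y [I [iI ->]]]; exact: relative_projection_constant_le.
Qed.

End UpperBound.

(** * Averaging a projection *)

(** Joint continuity gives a neighbourhood at each point of the slice over V0, and compactness of T2
    makes it uniform. So g (V, .) varies continuously in supremum norm, to which a bounded P can be
    applied. *)
Lemma compact_equicontinuous (R : realType) (T1 T2 : topologicalType)
    (g : T1 * T2 -> Cx R) (V0 : T1) (d : R) :
  compact [set: T2] -> continuous g -> 0 < d ->
  \forall V \near V0, forall x, rnorm (g (V, x) - g (V0, x)) < d.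
Proof.
move=> /compact_near_coveringP cT cg d0.
have d20 : 0 < d / 2 by rewrite divr_gt0.
have h := cT T1 (nbhs V0) (fun V x => rnorm (g (V, x) - g (V0, x)) < d) (nbhs_filter V0).
apply: filterS (h _) => [V hV x|x _]; first exact: hV.
have /cvgCP/(_ _ d20) [[A B] /= [A0 Bx] AB] := cg (V0, x).
exists (B, A) => // -[x' V] /= [Bx' AV].
have -> : g (V, x') - g (V0, x') = (g (V, x') - g (V0, x)) + - (g (V0, x') - g (V0, x)).
  by rewrite opprB addrA subrK.
rewrite (splitr d); apply: le_lt_trans (rnormD _ _) _; rewrite rnormN.
apply: ltrD; first exact: (AB (V, x') (conj AV Bx')).
exact: (AB (V0, x') (conj (nbhs_singleton A0) Bx')).
Qed.

Lemma continuousCP (R : realType) (T : topologicalType) (f : T -> Cx R) :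
  (forall x (d : R), 0 < d -> \forall y \near x, rnorm (f y - f x) < d) -> continuous f.
Proof. by move=> h x; apply/cvgCP => d d0; exact: h. Qed.

Lemma continuous_slice (T1 T2 T3 : topologicalType) (b : T1 -> T2 -> T3) V :
  continuous (fun p : T1 * T2 => b p.1 p.2) -> continuous (b V).
Proof.
move=> cb x; apply: (@continuous_comp _ _ _ (fun y => (V, y)) (fun p => b p.1 p.2)); last exact: cb.
by apply: cvg_pair; [exact: cvg_cst|exact: cvg_id].
Qed.

Lemma continuous_composition (T1 T2 T3 : topologicalType) (f : T1 -> T2) (g : T2 -> T3) :
  continuous f -> continuous g -> continuous (g \o f).
Proof. by move=> cf cg x; apply: continuous_comp; [exact: cf|exact: cg]. Qed.

Section Averaging.
Variables (R : realType) (n : nat) (mu : probability (unitary_group R n) R).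
Local Notation U := (unitary_group R n).
Local Notation inner := (L2inner mu).
Variable S : set (U -> Cx R).
Implicit Types f g : U -> Cx R.
Hypothesis subS : is_subspace S.
Hypothesis SC : S `<=` @Cspace R n.
Variables (k : nat) (e : nat -> U -> Cx R).
Hypothesis eo : orthonormal_in mu S k e.
Hypothesis es : spanning mu S k e.

(** Boundedness as a pointwise estimate with a real constant, which passes directly through an
    integral over the group. *)
Definition projection_bound (M : R) (P : (U -> Cx R) -> U -> Cx R) :=
  [/\ linear_on (@Cspace R n) P,
      forall f b, continuous f -> (forall x, rnorm (f x) <= b) -> forall x, rnorm (P f x) <= M * b,
      forall f, continuous f -> S (P f) &
      forall f, S f -> P f = f].

Variables (a a' : U -> U -> U).
Hypothesis ac : continuous (fun p : (U * U)%type => a p.1 p.2).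
Hypothesis ac' : continuous (fun p : U * U => a' p.1 p.2).
Hypothesis aK : forall V x, a V (a' V x) = x.
Hypothesis aK' : forall V x, a' V (a V x) = x.
Hypothesis aS : forall V f, S f -> S (f \o a V).
Hypothesis aS' : forall V f, S f -> S (f \o a' V).

(** The maps [a V] and [a' V] stand for translation by V and by its inverse on either side, so one
    argument serves for both averages. *)
Definition average (P : (U -> Cx R) -> U -> Cx R) f : U -> Cx R :=
  fun x => cintegral mu (fun V => P (f \o a V) (a' V x)).

Section FixedProjection.
Variables (M : R) (P : (U -> Cx R) -> U -> Cx R).
Hypothesis PM : projection_bound M P.

Lemma continuous_translate V f : continuous f -> continuous (f \o a V).
Proof. by move=> cf; apply: continuous_composition => //; exact: continuous_slice ac. Qed.

Lemma projection_sub f g : continuous f -> continuous g -> P (f - g) = P f - P g.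
Proof.
move=> cf cg; have [Pl _ _ _] := PM.
by have := Pl (-1) g f cg cf; rewrite !scaleN1r (addrC (- g)) (addrC (- P g)).
Qed.

Lemma projection_bound_ge0 : 0 <= M.
Proof.
have [_ Pb _ _] := PM.
have c1 : continuous (fun _ : U => 1 : Cx R) by exact: continuous_cst.
have := Pb _ 1 c1 _ point; rewrite mulr1 => h.
by apply: le_trans (h _) => [|x]; [exact: rnorm_ge0|rewrite /rnorm normr1].
Qed.

Definition conjugate f V : U -> Cx R := P (f \o a V) \o a' V.

Lemma conjugate_in f V : continuous f -> S (conjugate f V).
Proof. by move=> cf; have [_ _ PS _] := PM; apply: aS'; apply: PS; exact: continuous_translate. Qed.

(** V occurs twice: inside P, where the bound M applies, and in the argument of the fixed continuous
    function P (f o a V0). Each change costs d / 2; the tolerance d' uses M + 1 because M may be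
    0. *)
Lemma conjugate_near f V0 (d : R) : continuous f -> 0 < d ->
  \forall V \near V0, forall x, rnorm (conjugate f V x - conjugate f V0 x) < d.
Proof.
move=> cf d0; have [_ Pb PS _] := PM; have M0 := projection_bound_ge0.
pose d' := d / (2 * (M + 1)).
have d'0 : 0 < d' by rewrite divr_gt0 // mulr_gt0 // ltr_wpDl.
have d20 : 0 < d / 2 by rewrite divr_gt0.
have cfV0 := @continuous_translate V0 f cf.
have n1 := compact_equicontinuous V0 (@compact_unitary R n) (continuous_composition ac cf) d'0.
have n2 := compact_equicontinuous V0 (@compact_unitary R n)
  (continuous_composition ac' (SC (PS _ cfV0))) d20.
apply: filterS (filterI n1 n2) => V [h1 h2] x.
have cfV := @continuous_translate V f cf.
have -> : conjugate f V x - conjugate f V0 x = P ((f \o a V) - (f \o a V0)) (a' V x) +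
    (P (f \o a V0) (a' V x) - P (f \o a V0) (a' V0 x)).
  rewrite (projection_sub cfV cfV0).
  exact: esym (subrKA (P (f \o a V0) (a' V x)) (P (f \o a V) (a' V x)) _).
rewrite (splitr d); apply: le_lt_trans (rnormD _ _) _.
apply: ler_ltD; last exact: h2.
apply: (@le_trans _ _ (M * d')).
  apply: Pb; last by move=> y; exact: ltW (h1 y).
  by move=> y; exact: cvgB (cfV y) (cfV0 y).
have M1 : M + 1 != 0 by rewrite gt_eqF // ltr_wpDl.
have -> : d / 2 = (M + 1) * d' by rewrite /d'; field.
by rewrite ler_pM2r // lerDl.
Qed.

Lemma conjugate_continuous f x : continuous f -> continuous (fun V => conjugate f V x).
Proof.
by move=> cf; apply: continuousCP => V0 d d0; apply: filterS (conjugate_near V0 cf d0) => V; exact.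
Qed.

Lemma conjugate_cintegrable f x : continuous f -> cintegrable mu (fun V => conjugate f V x).
Proof. by move=> cf; exact: continuous_cintegrable (@conjugate_continuous f x cf). Qed.

(** Each conjugate lies in S and its coefficients are continuous in V; the average is the
    combination with the integrated coefficients. *)
Lemma average_in f : continuous f -> S (average P f).
Proof.
move=> cf; pose c i V := inner (conjugate f V) (e i).
have cc i : (i < k)%N -> continuous (c i).
  move=> ik; have ce := SC (eo.1 i ik); have [B eB] := continuous_complex_bounded ce.
  apply: continuousCP => V0 d d0.
  have B0 : 0 <= B by exact: le_trans (rnorm_ge0 _) (eB point).
  have d'0 : 0 < d / (2 * (B + 1)) by rewrite divr_gt0 // mulr_gt0 // ltr_wpDl.
  apply: filterS (conjugate_near V0 cf d'0) => V hV.
  have LV := subset_L2 mu SC (conjugate_in V cf); have LV0 := subset_L2 mu SC (conjugate_in V0 cf).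
  have Le := subset_L2 mu SC (eo.1 i ik).
  rewrite /c -L2innerB //.
  apply: le_lt_trans (rnorm_cintegral_le (L2_mul (L2_sub LV LV0) Le)) _.
  apply: (@le_lt_trans _ _ (\int[mu]_x (cst (d / (2 * (B + 1)) * B) : U -> R) x)).
    apply: Rintegral_le => [||x].
    - exact: cintegrable_rnorm (L2_mul (L2_sub LV LV0) Le).
    - by apply: continuous_rintegrable; exact: cst_continuous.
    by rewrite rnormM rnormJ ler_pM ?rnorm_ge0 ?eB // ltW // hV.
  rewrite Rintegral_constant mulrAC ltr_pdivrMr ?mulr_gt0 ?ltr_wpDl //.
  by rewrite ltr_pM2l //; lra.
rewrite (_ : average P f = combination k e (fun i => cintegral mu (c i))).
  by apply: (combination_in subS); exact: eo.1.
apply/funext => x; rewrite combinationE /average.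
rewrite (_ : (fun V => _) = (fun V => \sum_(i < k) c i V * e i x)); last first.
  apply/funext => V; rewrite -[LHS]/(conjugate f V x) [in LHS](es (conjugate_in V cf)).
  by rewrite combinationE.
have : forall m, (m <= k)%N -> cintegrable mu (fun V => \sum_(i < m) c i V * e i x) /\
    cintegral mu (fun V => \sum_(i < m) c i V * e i x) = \sum_(i < m) cintegral mu (c i) * e i x.
  have c0 : cintegrable mu (fun _ : U => 0 : Cx R).
    by apply: continuous_cintegrable; exact: continuous_cst.
  elim=> [_|m IH mk].
    rewrite big_ord0 (_ : (fun V => _) = (fun _ : U => 0 : Cx R)); last first.
      by apply/funext => V; rewrite big_ord0.
    by split => //; rewrite /cintegral /= !Rintegral_constant.
  have [i1 e1] := IH (ltnW mk).
  have i2 := continuous_cintegrable mu (cc m mk).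
  have i3 := cintegrableZ (e m x) i2.
  have -> : (fun V => \sum_(i < m.+1) c i V * e i x) =
      (fun V => \sum_(i < m) c i V * e i x) + (fun V => e m x * c m V).
    by apply/funext => V; rewrite big_ord_recr /= [X in _ + X]mulrC.
  split; first exact: cintegrableD.
  by rewrite cintegralD // e1 cintegralZ // big_ord_recr /= [X in _ + X]mulrC.
by move=> /(_ k (leqnn k))[].
Qed.

Lemma average_projection : projection_bound M (average P).
Proof.
have [Pl Pb PS PP] := PM; split.
- move=> c f g cf cg; apply/funext => x.
  rewrite -[RHS]/(c * average P f x + average P g x) /average.
  have jf := conjugate_cintegrable x cf; have jg := conjugate_cintegrable x cg.
  rewrite -(cintegralZ c jf) -(cintegralD (cintegrableZ c jf) jg); congr cintegral.
  apply/funext => V.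
  have E : P ((c *: f + g) \o a V) = c *: P (f \o a V) + P (g \o a V).
    exact (Pl c _ _ (@continuous_translate V f cf) (@continuous_translate V g cg)).
  by rewrite E.
- move=> f b cf fb x.
  have j := conjugate_cintegrable x cf.
  apply: le_trans (rnorm_cintegral_le j) _.
  rewrite -[leRHS](Rintegral_constant mu); apply: Rintegral_le => [||V].
  + exact: cintegrable_rnorm.
  + by apply: continuous_rintegrable; exact: cst_continuous.
  by apply: Pb => [|y]; [exact: continuous_translate|exact: fb].
- exact: average_in.
move=> f Sf; apply/funext => x; rewrite /average.
rewrite (_ : (fun V => _) = (fun=> f x)); last first.
  by apply/funext => V; rewrite PP ?[LHS]/= ?aK //; exact: aS.
by rewrite /cintegral !Rintegral_constant; case: (f x).
Qed.

(** For the second average: with b a left translation and a the right ones, the left symmetry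
    already obtained is not lost. *)
Lemma average_commutes_other (b : U -> U) : continuous b ->
  (forall V x, a V (b x) = b (a V x)) -> (forall V x, a' V (b x) = b (a' V x)) ->
  (forall f, continuous f -> P (f \o b) = P f \o b) ->
  forall f, continuous f -> average P (f \o b) = average P f \o b.
Proof.
move=> cb ab a'b Pb f cf; apply/funext => x; rewrite /average /=.
congr cintegral; apply/funext => V; rewrite a'b.
have -> : (f \o b) \o a V = (f \o a V) \o b by apply/funext => y /=; rewrite ab.
by rewrite (Pb _ (@continuous_translate V f cf)).
Qed.

(** Here tau is the translation of the index V caused by composing with [a W]; substituting tau V
    for V in the integral moves [a W] outside. *)
Lemma average_commutes (W : U) (tau : U -> U) : preserving mu tau ->
  (forall V x, a W (a V x) = a (tau V) x) ->
  forall f, continuous f -> average P (f \o a W) = average P f \o a W.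
Proof.
move=> ptau aW f cf; apply/funext => x; rewrite /average /=.
rewrite -(cintegral_preserving ptau (@conjugate_cintegrable f (a W x) cf)).
congr cintegral; apply/funext => V; rewrite /conjugate /=.
have -> : (f \o a W) \o a V = f \o a (tau V) by apply/funext => y /=; rewrite aW.
by congr (P _ _); rewrite -[in RHS](aK V x) aW aK'.
Qed.

End FixedProjection.

End Averaging.

(** * The lower bound *)

Lemma continuous_prod_fst (T1 T2 : topologicalType) : continuous (@fst T1 T2).
Proof. by move=> x; exact: cvg_fst. Qed.

Lemma continuous_prod_snd (T1 T2 : topologicalType) : continuous (@snd T1 T2).
Proof. by move=> x; exact: cvg_snd. Qed.

Lemma continuous_rinv (R : realType) (T : topologicalType) (f : T -> R) :
  continuous f -> (forall x, f x != 0) -> continuous (fun x => (f x)^-1).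
Proof. by move=> cf f0 x; apply: cvgV; [exact: f0|exact: cf]. Qed.

Section LowerBound.
Variables (R : realType) (n : nat) (mu : probability (unitary_group R n) R).
Local Notation U := (unitary_group R n).
Local Notation inner := (L2inner mu).
Variable S : set (U -> Cx R).
Implicit Types f g : U -> Cx R.
Hypothesis haar : is_haar mu.
Hypothesis subS : is_subspace S.
Hypothesis SC : S `<=` @Cspace R n.
Hypothesis invS : unitary_invariant S.
Variables (k : nat) (e : nat -> U -> Cx R).
Hypothesis eo : orthonormal_in mu S k e.
Hypothesis es : spanning mu S k e.
Hypothesis accS : accessible mu S.
Local Notation t := (rkernel k e (unitary1 R n)).
Local Notation opnormC := (opnorm (@supnorm R n) (@Cspace R n) (@supnorm R n)).

Lemma equivariant_projection M P : projection_bound S M P ->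
  exists2 Q, projection_bound S M Q & commutes_with_action Q.
Proof.
move=> PM.
have cfst := @continuous_prod_fst U U; have csnd := @continuous_prod_snd U U.
have cfstV := continuous_unitaryV cfst.
have la : continuous (fun p : (U * U)%type => translL p.1 p.2) by exact: continuous_unitaryM.
have la' : continuous (fun p : (U * U)%type => translL (unitaryV p.1) p.2).
  exact: continuous_unitaryM.
have ra : continuous (fun p : (U * U)%type => translR p.1 p.2) by exact: continuous_unitaryM.
have ra' : continuous (fun p : (U * U)%type => translR (unitaryV p.1) p.2).
  exact: continuous_unitaryM.
have lK (V x : U) : translL V (translL (unitaryV V) x) = x.
  by rewrite /translL unitaryA unitaryMV unitary1M.
have lK' (V x : U) : translL (unitaryV V) (translL V x) = x.
  by rewrite /translL unitaryA unitaryVM unitary1M.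
have rK (V x : U) : translR V (translR (unitaryV V) x) = x.
  by rewrite /translR -unitaryA unitaryVM unitaryM1.
have rK' (V x : U) : translR (unitaryV V) (translR V x) = x.
  by rewrite /translR -unitaryA unitaryMV unitaryM1.
have Sl V f : S f -> S (f \o translL V) by move=> Sf; exact: (invS V Sf).1.
have Sr V f : S f -> S (f \o translR V) by move=> Sf; exact: (invS V Sf).2.
pose l' V := translL (unitaryV V) : U -> U.
pose r' V := translR (unitaryV V) : U -> U.
have Sl' V f : S f -> S (f \o l' V) by exact: Sl.
have Sr' V f : S f -> S (f \o r' V) by exact: Sr.
pose Q1 := average mu (@translL R n) l' P.
have Q1M : projection_bound S M Q1 := average_projection subS SC eo es la la' lK Sl Sl' PM.
have Q1l V f : continuous f -> Q1 (f \o translL V) = Q1 f \o translL V.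
  apply: (average_commutes SC la la' lK lK' PM (preserving_translL haar V)) => //.
  by move=> X x; rewrite /translL unitaryA.
pose Q := average mu (@translR R n) r' Q1.
have QM : projection_bound S M Q := average_projection subS SC eo es ra ra' rK Sr Sr' Q1M.
exists Q; first exact: QM.
move=> V W f cf.
have Qr g : continuous g -> Q (g \o translR W) = Q g \o translR W.
  apply: (average_commutes SC ra ra' rK rK' Q1M (preserving_translR haar W)).
  by move=> X x; rewrite /translR unitaryA.
have Ql g : continuous g -> Q (g \o translL V) = Q g \o translL V.
  apply: (average_commutes_other mu ra (@continuous_translL R n V)).
  - by move=> X x; rewrite /translR /translL unitaryA.
  - by move=> X x; rewrite /r' /translR /translL unitaryA.
  - by move=> h; exact: Q1l.
rewrite -(Qr f cf).
exact: esym (Ql _ (continuous_composition (@continuous_translR R n W) cf)).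
Qed.

Lemma opnorm_le_projection M P : projection_bound S M P ->
  (opnormC (L2proj mu S) <= M%:E)%E.
Proof.
move=> /equivariant_projection[Q [Ql Qb QS QQ] Qc].
have Qle f x : continuous f -> (supnorm f <= 1)%E -> rnorm (Q f x) <= M.
  move=> cf f1; rewrite -[leRHS]mulr1; apply: Qb => // y.
  exact: le_supnorm f1.
have Qop : (opnormC Q <= M%:E)%E.
  by apply: ge_ereal_sup => _ [f [cf f1] <-]; apply: supnorm_le => x; exact: Qle.
have Qproj : bounded_projection (@supnorm R n) (@Cspace R n) S Q.
  by split => //; exact: le_lt_trans Qop (ltry _).
apply: ge_ereal_sup => _ [f [cf f1] <-].
rewrite -(accS Qproj Qc cf); apply: supnorm_le => x; exact: Qle.
Qed.

Lemma opnorm_le_projection_constant :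
  (opnormC (L2proj mu S) <= projection_constant (@supnorm R n) S)%E.
Proof.
pose w f : linf R U := insubd 0 f.
have cb f : continuous f -> f \in @bounded_functions R U.
  by move=> cf; apply/bounded_functionsP; exact: continuous_complex_bounded.
have wK f : continuous f -> (w f : U -> Cx R) = f by move=> cf; apply: insubdK; exact: cb.
have w_lin c f g : continuous f -> continuous g -> w (c *: f + g) = c *: w f + w g.
  move=> cf cg; apply: val_inj; rewrite /= insubdK ?rpredD ?rpredZ ?cb //.
  by rewrite (wK f cf) (wK g cg).
have wle f b : continuous f -> (forall x, rnorm (f x) <= b) -> rnorm (w f) <= b.
  by move=> cf fb; apply: supremum_le => x; rewrite -[linf_val _]/(w f : U -> Cx R) wK.
have iw : isometric_embedding (@supnorm R n) S w.
  split; first by move=> c f g Sf Sg; apply: w_lin; exact: SC.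
  move=> f Sf; have cf := SC Sf; apply/eqP; rewrite eq_le; apply/andP; split.
    have [M fM] := continuous_complex_bounded cf.
    have fin : supnorm f \is a fin_num.
      rewrite fin_numE; apply/andP; split; last first.
        by apply/eqP => fy; have := supnorm_le fM; rewrite fy leye_eq.
      apply/eqP => fy; have : ((rnorm (f point))%:E <= supnorm f)%E.
        by apply: ereal_sup_ubound; exists point.
      by rewrite fy leeNy_eq.
    rewrite -(fineK fin) lee_fin; apply: wle => // x.
    by apply: le_supnorm; rewrite fineK.
  by apply: supnorm_le => x; rewrite -[in leLHS](wK f cf) linf_le_rnorm.
apply: le_trans (_ : relative_projection_constant (w @` S) <= _)%E; last first.
  by apply: ereal_sup_ubound; exists (linf R U), w.
apply: le_ereal_inf_tmp => _ [P [Pl Pfin PS PP] <-].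
set M := opnorm _ _ _ P in Pfin *.
have P0 : P 0 = 0.
  have := Pl 1 0 0 I I; rewrite scaler0 addr0 scale1r => /eqP.
  by rewrite -subr_eq subrr => /eqP.
(* [Pfin] excludes +oo and P 0 = 0 excludes -oo, so M is a real number. *)
have M0 : (0 <= M)%E.
  apply: ereal_sup_ubound; exists 0; last by rewrite P0 /enorm rnorm0.
  by split => //; rewrite /enorm rnorm0 lee_fin.
have Mfin : M \is a fin_num by rewrite ge0_fin_numE.
rewrite -(fineK Mfin); apply: (@opnorm_le_projection _ (fun f => P (w f) : U -> Cx R)).
have Pv v : enorm v = 1%E -> rnorm (P v) <= fine M.
  move=> v1; rewrite -lee_fin fineK //; apply: ereal_sup_ubound.
  by exists v => //; split => //; rewrite v1.
split.
- by move=> c f g cf cg; rewrite (w_lin c f g cf cg) (Pl c _ _ I I).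
- move=> f b cf fb x; apply: le_trans (linf_le_rnorm (P (w f)) x) _.
  have wb := wle f b cf fb.
  (* [Pv] is available on the unit sphere only: a nonzero w f is normalized by c, and the zero
     vector is treated apart. *)
  have [w0|wn] := eqVneq (rnorm (w f)) 0.
    rewrite (rnorm_eq0 w0) P0 rnorm0 mulr_ge0 ?fine_ge0 //.
    exact: le_trans (rnorm_ge0 _) wb.
  have wp : 0 < rnorm (w f) by rewrite lt0r wn rnorm_ge0.
  apply: (@le_trans _ _ (fine M * rnorm (w f))); last by rewrite ler_wpM2l ?fine_ge0.
  pose c : Cx R := ((rnorm (w f))^-1%:C)%C.
  have rc : rnorm c = (rnorm (w f))^-1 by rewrite rnormr ger0_norm // invr_ge0 ltW.
  have := Pv (c *: w f); rewrite /enorm rnormZ rc mulVf // => /(_ erefl).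
  have PZ : P (c *: w f) = c *: P (w f) by have := Pl c (w f) 0 I I; rewrite P0 !addr0.
  by rewrite PZ rnormZ rc mulrC ler_pdivrMr.
- move=> f cf; have [g Sg <-] := PS (w f) I; by rewrite (wK _ (SC Sg)).
- move=> f Sf; rewrite PP; last by exists f.
  exact: wK (SC Sf).
Qed.

Lemma Rintegral_kernel_le_opnorm :
  ((\int[mu]_x rnorm (t x))%:E <= opnormC (L2proj mu S))%E.
Proof.
have St : S t := rkernel_in subS eo (unitary1 R n); have ct := SC St.
have nt := continuous_rnorm ct.
apply/lee_addgt0Pr => d d0.
have dn x : rnorm (t x) + d != 0 by rewrite gt_eqF // ltr_wpDl ?rnorm_ge0.
have cn : continuous (fun x => rnorm (t x) + d).
  by move=> x; exact: cvgD (nt x) (@cst_continuous _ _ d x).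
pose r x := (rnorm (t x) + d)^-1.
have cr : continuous r by exact: continuous_rinv.
pose f : U -> Cx R := fun x => ((r x)%:C)%C * t x.
have cf : continuous f by exact: (continuous_mul (continuous_realC cr) ct).
have r0 x : 0 <= r x by rewrite invr_ge0 addr_ge0 ?rnorm_ge0 // ltW.
have f1 : (supnorm f <= 1)%E.
  apply: supnorm_le => x; rewrite rnormM rnormr ger0_norm //.
  by rewrite mulrC ler_pdivrMr ?mul1r ?lerDl ?ltW // ltr_wpDl ?rnorm_ge0.
have Lf := continuous_L2 mu cf.
have e1 : L2proj mu S f (unitary1 R n) = inner f t by exact: (L2proj_kernel haar subS SC eo es).
have lower : \int[mu]_x rnorm (t x) - d <= rnorm (inner f t).
  apply: le_trans (Re_le _).
  have cft : continuous (fun x => f x * (t x)^* ) by exact: (continuous_mul cf (continuous_conj ct)).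
  have it : rintegrable mu (fun x => rnorm (t x)) by exact: continuous_rintegrable.
  have id1 : rintegrable mu (fun _ : U => d) by apply: continuous_rintegrable; exact: cst_continuous.
  rewrite -[X in _ - X](Rintegral_constant mu) -RintegralB //.
  apply: Rintegral_le => [||x].
  - exact: rintegrableD it (rintegrableN id1).
  - exact: (continuous_cintegrable mu cft).1.
  have -> : Re (f x * (t x)^* ) = r x * rnorm (t x) ^+ 2.
    by rewrite /f -mulrA -normCK normE -rmorphXn -rmorphM.
  (* The integrand f conj t is |t|^2 / (|t| + d), and it is at least |t| - d because (|t| - d) (|t|
     + d) = |t|^2 - d^2. *)
  rewrite /r mulrC ler_pdivlMr ?ltr_wpDl ?rnorm_ge0 //.
  by have := sqr_ge0 d; lra.
apply: (@le_trans _ _ ((rnorm (L2proj mu S f (unitary1 R n)))%:E + d%:E)%E).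
  by rewrite e1 lee_fin; lra.
rewrite leeD2r //; apply: (@le_trans _ _ (supnorm (L2proj mu S f))).
  by apply: ereal_sup_ubound; exists (unitary1 R n).
by apply: ereal_sup_ubound; exists f.
Qed.

End LowerBound.

Theorem theorem2p6 (R : realType) (n : nat)
    (mu : probability (unitary_group R n) R) (S : set (unitary_group R n -> Cx R)) :
  is_haar mu ->
  is_subspace S ->
  S `<=` @Cspace R n ->
  unitary_invariant S ->
  L2closed mu S ->
  accessible mu S ->
  projection_constant (@supnorm R n) S
    = opnorm (@supnorm R n) (@Cspace R n) (@supnorm R n) (L2proj mu S)
  /\
  opnorm (@supnorm R n) (@Cspace R n) (@supnorm R n) (L2proj mu S)
    = (\int[mu]_V (rnorm (repr_kernel mu S V))%:E)%E.
Proof.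
move=> haar subS SC invS clS accS.
have [k [e [eo es]]] := orthonormal_basis_ex haar subS SC clS.
have h1 := projection_constant_le haar subS SC invS eo es.
have h2 := opnorm_le_projection_constant haar subS SC invS eo es accS.
have h3 := Rintegral_kernel_le_opnorm haar subS SC eo es.
have ct : continuous (fun x => rnorm (rkernel k e (unitary1 R n) x)).
  by apply: continuous_rnorm; apply: SC; exact: (rkernel_in subS eo).
have -> : (\int[mu]_V (rnorm (repr_kernel mu S V))%:E =
    (\int[mu]_x rnorm (rkernel k e (unitary1 R n) x))%:E)%E.
  rewrite (repr_kernelE haar subS SC eo es) /Rintegral fineK //.
  by apply: integrable_fin_num => //; exact: continuous_rintegrable.
split; apply/eqP; rewrite eq_le; apply/andP; split.
- exact: le_trans h1 h3.
- exact: h2.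
- exact: le_trans h2 h1.
- exact: h3.
Qed.
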